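(* Let $\sigma>0$ and suppose $\overline{H}$ is differentiable at $P\in\mathbb{R}^n$. Let $x(t)$ be the optimally controlled diffusion in $\mathbb{R}^n$, $$dx=-D_pH(P+D_xu(x,P),x)\,dt+\sigma\,dw .$$ Then $$\lim_{t\to\infty}E\,\frac{x(t)}{t}=-D_P\overline{H}(P).$$
   Context: Let $\mathbb{T}^n=\mathbb{R}^n/\mathbb{Z}^n$. The Lagrangian $L(x,v)$, $x,v\in\mathbb{R}^n$, is smooth in both variables, $\mathbb{Z}^n$-periodic in $x$, coercive and strictly convex in $v$, and $L\ge0$; there is a function $\gamma=\gamma(|v|)\ge 1$ with $L(x,v)/\gamma(v)\to+\infty$ and $|v|/\gamma(v)\to0$ as $|v|\to\infty$. Set $H(p,x)=\sup_v(-p\cdot v-L(x,v))$. For $P\in\mathbb{R}^n$, $\overline{H}(P)$ is the unique real number for which $$-\frac{\sigma^2}{2}\Delta u+H(P+D_xu,x)=\overline{H}(P)$$ has a $\mathbb{Z}^n$-periodic viscosity solution $u(x,P)$; this solution is $C^2$ in $x$ and unique up to an additive constant. $w$ is an $n$-dimensional Brownian motion, $E$ denotes expectation, and $x(0)$ is a fixed initial point of $\mathbb{R}^n$ (the universal covering of $\mathbb{T}^n$). *)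

(* Defs.v *)
(* MathComp + MathComp-Analysis *)
From HB Require Import structures.
From mathcomp Require Import all_boot all_order all_algebra.
From mathcomp Require Import all_classical all_reals all_analysis.

Set Implicit Arguments.
Unset Strict Implicit.
Unset Printing Implicit Defensive.

Import Order.TTheory GRing.Theory Num.Theory.
Import numFieldNormedType.Exports.

Local Open Scope classical_set_scope.
Local Open Scope ring_scope.

Definition dotp (R : realType) (n : nat) (u v : 'rV[R]_n) : R :=
  \sum_(i < n) u 0 i * v 0 i.

(* The library norm on row vectors is the sup norm, hence a separate name. *)
Definition enorm (R : realType) (n : nat) (v : 'rV[R]_n) : R :=
  Num.sqrt (dotp v v).

(* The filter "|v| -> +oo" on R^n. *)
Definition at_infinity (R : realType) (n : nat) : set_system 'rV[R]_n :=
  fun A => \forall r \near +oo, forall v, r <= enorm v -> A v.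

Definition grad (R : realType) (n : nat) (f : 'rV[R]_n -> R) (x : 'rV[R]_n) :
    'rV[R]_n :=
  \row_i 'D_(delta_mx 0 i) f x.

Definition laplacian (R : realType) (n : nat) (f : 'rV[R]_n -> R)
    (x : 'rV[R]_n) : R :=
  \sum_(i < n) 'D_(delta_mx 0 i) ('D_(delta_mx 0 i) f) x.

(* Class C^k through directional derivatives; used only for finite-dimensional
   V, where this agrees with the usual notion. *)
Fixpoint Ck (R : realType) (V : normedModType R) (k : nat) (f : V -> R) : Prop :=
  match k with
  | 0%N => continuous f
  | k'.+1 => (forall x, differentiable f x) /\ forall v, Ck k' ('D_v f)
  end.

Definition smooth (R : realType) (V : normedModType R) (f : V -> R) : Prop :=
  forall k, Ck k f.

Definition periodic (R : realType) (n : nat) (f : 'rV[R]_n -> R) : Prop :=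
  forall (x : 'rV[R]_n) (k : 'rV[int]_n), f (x + map_mx intr k) = f x.

(* Arguments of L are ordered as in L(x, v). *)
Record lagrangian (R : realType) (n : nat) (L : 'rV[R]_n -> 'rV[R]_n -> R) :
    Prop := Lagrangian {
  lagrangian_smooth :
    smooth (fun z : 'rV[R]_n * 'rV[R]_n => L z.1 z.2);
  lagrangian_periodic : forall v, periodic (fun x => L x v);
  lagrangian_coercive : forall x, L x v @[v --> @at_infinity R n] --> +oo;
  lagrangian_strictly_convex : forall x (v w : 'rV[R]_n) (t : R), v != w -> 0 < t < 1 ->
    L x (t *: v + (1 - t) *: w) < t * L x v + (1 - t) * L x w;
  lagrangian_ge0 : forall x v, 0 <= L x v;
  lagrangian_growth : exists gamma : R -> R,
    [/\ forall s : R, 0 <= s -> 1 <= gamma s,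
        forall x, L x v / gamma (enorm v) @[v --> @at_infinity R n] --> +oo
      & enorm v / gamma (enorm v) @[v --> @at_infinity R n] --> (0 : R)]
}.

(* The growth condition on L makes this supremum finite. *)
Definition hamiltonian (R : realType) (n : nat)
    (L : 'rV[R]_n -> 'rV[R]_n -> R) (p x : 'rV[R]_n) : R :=
  sup [set - dotp p v - L x v | v in setT].

(* Viscosity solutions of  - sigma^2/2 Delta u + H(P + D u, x) = lam  in R^n. *)
Definition viscosity_solution (R : realType) (n : nat)
    (H : 'rV[R]_n -> 'rV[R]_n -> R) (sigma : R) (P : 'rV[R]_n) (lam : R)
    (u : 'rV[R]_n -> R) : Prop :=
  let op (phi : 'rV[R]_n -> R) x :=
    - (sigma ^+ 2 / 2) * laplacian phi x + H (P + grad phi x) x in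
  [/\ continuous u,
      forall (phi : 'rV[R]_n -> R) (x : 'rV[R]_n), Ck 2 phi ->
        (\forall y \near x, u y - phi y <= u x - phi x) -> op phi x <= lam
    & forall (phi : 'rV[R]_n -> R) (x : 'rV[R]_n), Ck 2 phi ->
        (\forall y \near x, u x - phi x <= u y - phi y) -> lam <= op phi x].

(* Hbar P is the one and only constant for which the cell problem at P has a
   periodic viscosity solution. *)
Definition effective_hamiltonian (R : realType) (n : nat)
    (H : 'rV[R]_n -> 'rV[R]_n -> R) (sigma : R) (Hbar : 'rV[R]_n -> R) : Prop :=
  forall P lam,
    (exists u, periodic u /\ viscosity_solution H sigma P lam u) <->
    lam = Hbar P.

(* x |-> u x P is a periodic C^2 solution of the cell problem at P, for every
   P. *)
Definition corrector (R : realType) (n : nat)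
    (H : 'rV[R]_n -> 'rV[R]_n -> R) (sigma : R) (Hbar : 'rV[R]_n -> R)
    (u : 'rV[R]_n -> 'rV[R]_n -> R) : Prop :=
  forall P, [/\ periodic (u ^~ P),
                viscosity_solution H sigma P (Hbar P) (u ^~ P)
              & Ck 2 (u ^~ P)].

(* Processes are indexed by R; only times t >= 0 matter. *)
Definition filtration (R : realType) (d : measure_display)
    (T : measurableType d) (F : R -> set (set T)) : Prop :=
  (forall t : R, 0 <= t -> sigma_algebra setT (F t) /\ F t `<=` measurable) /\
  (forall s t : R, 0 <= s -> s <= t -> F s `<=` F t).

Definition adapted (R : realType) (n : nat) (d : measure_display)
    (T : measurableType d) (F : R -> set (set T)) (X : R -> T -> 'rV[R]_n) :
    Prop :=
  forall t : R, 0 <= t -> forall (i : 'I_n) (B : set R), measurable B ->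
    F t [set omega | B (X t omega 0 i)].

Definition continuous_paths (R : realType) (n : nat) (d : measure_display)
    (T : measurableType d) (Pr : probability T R) (X : R -> T -> 'rV[R]_n) :
    Prop :=
  {ae Pr, forall omega, {within `[0, +oo[, continuous (X ^~ omega)}}.

(* The product formula says at once that the increment w_t - w_s is independent
   of F_s, and that its coordinates are independent with law N(0, t - s); the
   second parameter of normal_prob is the standard deviation. *)
Definition brownian_motion (R : realType) (n : nat) (d : measure_display)
    (T : measurableType d) (Pr : probability T R) (F : R -> set (set T))
    (w : R -> T -> 'rV[R]_n) : Prop :=
  [/\ adapted F w,
      {ae Pr, forall omega, w 0 omega = 0},
      continuous_paths Pr w
    & forall s t : R, 0 <= s -> s < t ->
      forall (A : set T) (B : 'I_n -> set R),
        F s A -> (forall i, measurable (B i)) ->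
        Pr (A `&` [set omega | forall i, B i ((w t omega - w s omega) 0 i)]) =
        (Pr A * \prod_(i < n) normal_prob 0 (Num.sqrt (t - s)) (B i))%E].

(* dX = b(X) dt + sigma dw, X(0) = x0. As the noise is additive, the stochastic
   integral of the constant sigma is sigma * w_t. *)
Definition diffusion (R : realType) (n : nat) (d : measure_display)
    (T : measurableType d) (Pr : probability T R) (F : R -> set (set T))
    (w : R -> T -> 'rV[R]_n) (b : 'rV[R]_n -> 'rV[R]_n) (sigma : R)
    (x0 : 'rV[R]_n) (X : R -> T -> 'rV[R]_n) : Prop :=
  [/\ adapted F X,
      continuous_paths Pr X
    & {ae Pr, forall omega, forall t : R, 0 <= t -> forall i : 'I_n,
        lebesgue_measure.-integrable `[0, t]
          (fun s => (b (X s omega) 0 i)%:E) /\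
        X t omega 0 i = x0 0 i
          + \int[lebesgue_measure]_(s in `[0, t]) b (X s omega) 0 i
          + sigma * w t omega 0 i}].

(* Main.v *)
(**
For P' in R^n put phi = u(., P') - u(., P), and let v = - D_p H(P + D u(., P), .)
be the optimal drift. The Legendre inequality for H at P', with equality at P,
turns the difference of the two cell problems into
  sigma^2/2 Delta phi + (D phi + P' - P) . v >= - (Hbar P' - Hbar P).
By Ito's formula in expectation,
  E [phi (x t) + (P' - P) . x t] >=
    phi (x 0) + (P' - P) . x 0 - t (Hbar P' - Hbar P).
As phi is bounded, dividing by t and letting P' tend to P along +/- e_i gives the
limit. In place of Ito's formula, a second order Taylor expansion of
phi + (P' - P) . x over a short time bounds the lower Dini derivative of the
left-hand side, using only the moments of the Brownian increments and their
independence of the past.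
*)
Require Import Defs.
From HB Require Import structures.
From mathcomp Require Import all_boot all_order all_algebra.
From mathcomp Require Import all_classical all_reals all_analysis.
From mathcomp Require Import ring lra measurable_realfun.

Set Implicit Arguments.
Unset Strict Implicit.
Unset Printing Implicit Defensive.

Import Order.TTheory GRing.Theory Num.Theory.
Import numFieldNormedType.Exports.

Local Open Scope classical_set_scope.
Local Open Scope ring_scope.

(** * Continuity of minimisers *)

(** No differentiability of [H] is assumed. Strict convexity of [L] in [v] makes the minimiser of
    [p . v + L(x, v)] unique and continuous in [(p, x)]; this alone gives [H] its partial
    derivatives in [p] and makes the optimal drift continuous, hence bounded by periodicity. The
    second derivatives of phi are merely continuous, so the Taylor remainder is kept in the form
    [(e + K |v|^2) |v|^2]. Over a step of length [h] its first part has mean of order [e h], with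
    [e] as small as desired, and its second part has mean of order [h^2], by the fourth moment of
    the noise. The drift term is the delicate one: its first order in [h] is obtained by dominated
    convergence along [h = 1/(k+1)], at each fixed time and without uniformity in time. Hence a Dini
    derivative, to be combined with a rough bound on increments that is uniform in time. *)

Section continuous_functions.
Variables (R : realType) (T U V : topologicalType).

Lemma continuous_pair (f : T -> U) (g : T -> V) :
  continuous f -> continuous g -> continuous (fun z => (f z, g z)).
Proof. by move=> cf cg z; apply: cvg_pair; [exact: cf|exact: cg]. Qed.

Lemma continuous_fst : continuous (fun z : T * U => z.1).
Proof. by move=> z; exact: cvg_fst. Qed.

Lemma continuous_snd : continuous (fun z : T * U => z.2).
Proof. by move=> z; exact: cvg_snd. Qed.

Lemma continuous_compose (f : T -> U) (g : U -> V) :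
  continuous g -> continuous f -> continuous (fun z => g (f z)).
Proof. by move=> cg cf z; apply: continuous_comp; [exact: cf|exact: cg]. Qed.

Lemma continuous_sub (f g : T -> R) :
  continuous f -> continuous g -> continuous (fun z => f z - g z).
Proof. by move=> cf cg z; apply: cvgB; [exact: cf|exact: cg]. Qed.

Lemma continuous_add (f g : T -> R) :
  continuous f -> continuous g -> continuous (fun z => f z + g z).
Proof. by move=> cf cg z; apply: cvgD; [exact: cf|exact: cg]. Qed.

Lemma continuous_mul (f g : T -> R) :
  continuous f -> continuous g -> continuous (fun z => f z * g z).
Proof. by move=> cf cg z; apply: cvgM; [exact: cf|exact: cg]. Qed.

End continuous_functions.

Section dotp_theory.
Variables (R : realType) (n : nat).
Implicit Types u v w : 'rV[R]_n.

Lemma dotpDl u v w : dotp (u + v) w = dotp u w + dotp v w.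
Proof. by rewrite /dotp -big_split; apply: eq_bigr => i _; rewrite !mxE mulrDl. Qed.

Lemma dotpDr u v w : dotp u (v + w) = dotp u v + dotp u w.
Proof. by rewrite /dotp -big_split; apply: eq_bigr => i _; rewrite !mxE mulrDr. Qed.

Lemma dotpZl a u v : dotp (a *: u) v = a * dotp u v.
Proof. by rewrite /dotp big_distrr; apply: eq_bigr => i _; rewrite !mxE -mulrA. Qed.

Lemma dotpZr a u v : dotp u (a *: v) = a * dotp u v.
Proof. by rewrite /dotp big_distrr; apply: eq_bigr => i _; rewrite !mxE mulrCA. Qed.

Lemma dotp_delta i v : dotp (delta_mx 0 i) v = v 0 i.
Proof.
rewrite /dotp (bigD1 i)//= !mxE !eqxx mul1r big1 ?addr0// => j ji.
by rewrite !mxE (negbTE ji) andbF mul0r.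
Qed.

Lemma enorm_ge0 v : 0 <= enorm v.
Proof. exact: sqrtr_ge0. Qed.

Lemma coord_le_enorm v i : `|v 0 i| <= enorm v.
Proof.
rewrite -sqrtr_sqr ler_wsqrtr// /dotp (bigD1 i)//= expr2 lerDl.
by apply: sumr_ge0 => j _; rewrite -expr2 sqr_ge0.
Qed.

Lemma dotp_le_enorm u v : `|dotp u v| <= (\sum_i `|u 0 i|) * enorm v.
Proof.
rewrite (le_trans (ler_norm_sum _ _ _))// big_distrl/=.
by apply: ler_sum => i _; rewrite normrM ler_wpM2l// coord_le_enorm.
Qed.

Lemma coord_continuous_rV i : continuous (fun v : 'rV[R]_n => v 0 i).
Proof. exact: coord_continuous. Qed.

Lemma dotp_continuous : continuous (fun z : 'rV[R]_n * 'rV[R]_n => dotp z.1 z.2).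
Proof.
move=> z; rewrite /dotp; apply: (@cvg_big _ _ +%R) => /=.
  by move=> x; exact: add_continuous.
move=> i _; move: z; apply: continuous_mul.
  exact: (continuous_compose (@coord_continuous_rV i) (@continuous_fst _ _)).
exact: (continuous_compose (@coord_continuous_rV i) (@continuous_snd _ _)).
Qed.

End dotp_theory.

Section argmin.
Variables (R : realType) (n : nat) (Theta : topologicalType).
Variables (f : Theta -> 'rV[R]_n -> R) (v : Theta -> 'rV[R]_n).
Hypothesis f_continuous : continuous (fun z : Theta * 'rV[R]_n => f z.1 z.2).
Hypothesis f_convex : forall th (a b : 'rV[R]_n) (t : R), a != b -> 0 < t < 1 ->
  f th (t *: a + (1 - t) *: b) < t * f th a + (1 - t) * f th b.
Hypothesis v_min : forall th w, f th (v th) <= f th w.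

Lemma argmin_unique th w : w != v th -> f th (v th) < f th w.
Proof.
move=> wv; have h2 : 0 < (2^-1 : R) < 1 by lra.
have := f_convex th wv h2; set m := _ + _ => H.
have := v_min th m; lra.
Qed.

(* On a small sphere around [v th0] the values exceed the one at the centre,
   uniformly for nearby parameters; convexity then traps the minimiser inside. *)
Lemma argmin_continuous : continuous v.
Proof.
move=> th0; apply/cvgrPdist_le => /= e e0.
pose S := [set w : 'rV[R]_n | `|w - v th0| = e].
have Scompact : compact S.
  apply: bounded_closed_compact.
    exists (`|v th0| + e); split; first exact: num_real.
    move=> M HM w /= Sw; rewrite -(subrK (v th0) w) (le_trans (ler_normD _ _))//.
    by rewrite Sw addrC ltW.
  rewrite [S](_ : _ = (fun w => `|w - v th0|) @^-1` [set e])//.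
  apply: preimage_closed; last exact: closed_eq.
  move=> w _; apply: (@cvg_norm _ 'rV[R]_n _ (nbhs w)).
  by apply: cvgB; [exact: cvg_id|exact: cvg_cst].
have near_S : \forall th \near th0, forall w, S w -> f th (v th0) < f th w.
  (* Compactness of the sphere exchanges the quantifiers: a neighbourhood of [th0] for each [w]
     becomes one neighbourhood for all [w]. *)
  have := (compact_near_coveringP S).1 Scompact _ (nbhs th0)
    (fun th w => f th (v th0) < f th w) _.
  apply=> w Sw.
  have wv : w != v th0.
    by apply/eqP => wv; move: Sw; rewrite /S/= wv subrr normr0 => e0'; move: e0; rewrite -e0' ltxx.
  have lt0 := argmin_unique wv.
  pose g (z : 'rV[R]_n * Theta) := f z.2 z.1 - f z.2 (v th0).
  have gc : continuous g.
    apply: continuous_sub.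
      apply: (continuous_compose (f := fun z => (z.2, z.1)) f_continuous).
      by apply: continuous_pair; [exact: continuous_snd|exact: continuous_fst].
    apply: (continuous_compose (f := fun z => (z.2, v th0)) f_continuous).
    by apply: continuous_pair; [exact: continuous_snd|move=> ?; exact: cvg_cst].
  have g0 : 0 < g (w, th0) by rewrite subr_gt0.
  have [-[A B] /= [nA nB] sAB] := cvgr_gt _ (gc (w, th0)) _ g0.
  exists (A, B) => // -[a b] /= [Aa Bb].
  by have := sAB (a, b) (conj Aa Bb); rewrite /g/= subr_gt0.
near=> th.
rewrite distrC leNgt; apply/negP => far.
have d0 : 0 < `|v th - v th0| by rewrite (lt_trans e0).
(* With this ratio the point of the segment from [v th0] to [v th] lies exactly on the sphere. *)
pose t := e / `|v th - v th0|.
have t01 : 0 < t < 1 by rewrite divr_gt0//= ltr_pdivrMr// mul1r.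
have vv : v th != v th0 by apply/eqP => vv; move: d0; rewrite vv subrr normr0 ltxx.
have Sw : S (t *: v th + (1 - t) *: v th0).
  rewrite /S/= scalerBl scale1r addrA (addrAC _ (v th0)) -scalerBr addrK normrZ.
  by rewrite gtr0_norm ?(andP t01).1// /t divfK// gt_eqF.
have : forall w, S w -> f th (v th0) < f th w by near: th.
move=> /(_ _ Sw) H1.
have H2 := f_convex th vv t01.
have H3 := v_min th (v th0).
move: t01 => /andP[t0 t1].
nra.
Unshelve. all: by end_near.
Qed.

End argmin.

(** * The Legendre transform *)

Section legendre.
Variables (R : realType) (n : nat) (L : 'rV[R]_n -> 'rV[R]_n -> R).
Hypothesis hL : lagrangian L.

Lemma lagrangian_continuous :
  continuous (fun z : 'rV[R]_n * 'rV[R]_n => L z.1 z.2).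
Proof. exact: (lagrangian_smooth hL 0%N). Qed.

Let action (th : 'rV[R]_n * 'rV[R]_n) (v : 'rV[R]_n) := dotp th.1 v + L th.2 v.

Lemma action_continuous :
  continuous (fun z : ('rV[R]_n * 'rV[R]_n) * 'rV[R]_n => action z.1 z.2).
Proof.
apply: continuous_add.
  apply: (continuous_compose (f := fun z => (z.1.1, z.2)) (@dotp_continuous _ _)).
  apply: continuous_pair; last exact: continuous_snd.
  exact: (continuous_compose (@continuous_fst _ _) (@continuous_fst _ _)).
apply: (continuous_compose (f := fun z => (z.1.2, z.2)) lagrangian_continuous).
apply: continuous_pair; last exact: continuous_snd.
exact: (continuous_compose (@continuous_snd _ _) (@continuous_fst _ _)).
Qed.

Lemma action_convex th (a b : 'rV[R]_n) (t : R) : a != b -> 0 < t < 1 ->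
  action th (t *: a + (1 - t) *: b) < t * action th a + (1 - t) * action th b.
Proof.
move=> ab t01; have := lagrangian_strictly_convex hL th.2 ab t01.
rewrite /action dotpDr !dotpZr; lra.
Qed.

(** For large [v] the growth function dominates the linear term, [p . v >= - gamma], while
    [L(x, v) >= (1 + L(x, 0)) gamma]. The sum is at least [L(x, 0) gamma], and [gamma >= 1]. *)
Lemma action_large th : exists r : R, forall v, r <= enorm v ->
  action th 0 <= action th v.
Proof.
case: th => p x; have [gamma [g1 gL gv]] := lagrangian_growth hL.
pose C := \sum_i `|p 0 i|.
have C0 : 0 <= C by apply: sumr_ge0.
have /(_ [set y | 1 + L x 0 <= y]) := gL x.
have /[swap]/[apply] : nbhs +oo [set y : R | 1 + L x 0 <= y].
  by exists (1 + L x 0); split; [exact: num_real|move=> y /ltW].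
move=> [r1 [_ H1]].
have e0 : 0 < (C + 1)^-1 by rewrite invr_gt0; lra.
have [r2 [_ H2]] : (@at_infinity R n) [set v | enorm v / gamma (enorm v) <= (C + 1)^-1].
  apply: (gv [set y | y <= (C + 1)^-1]); apply/nbhs_ballP; exists (C + 1)^-1 => //= y.
  by rewrite /ball/= sub0r normrN => /ltW; exact: le_trans (ler_norm y).
(* Neighbourhoods of +oo are given by strict inequalities, so the threshold must exceed both [r1]
   and [r2]. *)
exists (Num.max r1 r2 + 1) => v rv.
have r1v : 1 + L x 0 <= L x v / gamma (enorm v).
  apply: (H1 (Num.max r1 r2 + 1) _ v rv).
  by rewrite (@le_lt_trans _ _ (Num.max r1 r2)) ?le_max ?lexx// ltrDl.
have r2v : enorm v / gamma (enorm v) <= (C + 1)^-1.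
  apply: (H2 (Num.max r1 r2 + 1) _ v rv).
  by rewrite (@le_lt_trans _ _ (Num.max r1 r2)) ?le_max ?lexx ?orbT// ltrDl.
have gv1 := g1 _ (enorm_ge0 v).
have g0 : 0 < gamma (enorm v) by lra.
move: r1v; rewrite ler_pdivlMr// => r1v.
move: r2v; rewrite ler_pdivrMr// => r2v.
have := dotp_le_enorm p v; rewrite -/C => pv.
have Lx0 := lagrangian_ge0 hL x 0.
rewrite /action /=.
have -> : dotp p (0 : 'rV[R]_n) = 0.
  by rewrite /dotp big1// => i _; rewrite mxE mulr0.
have h3 : C * enorm v <= gamma (enorm v).
  rewrite (@le_trans _ _ ((C + 1) * enorm v))//.
    by rewrite ler_wpM2r ?enorm_ge0//; lra.
  by rewrite -ler_pdivlMl//; lra.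
have h4 : - gamma (enorm v) <= dotp p v.
  by rewrite lerNl (le_trans _ (le_trans pv h3))// -normrN ler_norm.
have g1' : 0 <= gamma (enorm v) - 1 by lra.
have := mulr_ge0 Lx0 g1'; rewrite add0r.
move: (L x 0) (L x v) (gamma (enorm v)) (dotp p v) h4 r1v => a b c d0 /= h4 r1v.
lra.
Qed.

Lemma action_argmin th : exists v, forall w, action th v <= action th w.
Proof.
have [r Hr] := action_large th.
(* The sign of [r] is unknown; the absolute value keeps [0], with which the points outside are
   compared, in the box. *)
pose K := [set v : 'rV[R]_n | forall i, `[- `|r|, `|r|]%classic (v ord0 i)].
have Kc : compact K.
  by apply: (@rV_compact _ _ (fun=> `[- `|r|, `|r|]%classic)) => _; exact: segment_compact.
have K0 : K 0 by move=> i; rewrite /= mxE in_itv/= oppr_le0 normr_ge0.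
have [|v vK vmin] := EVT_min_rV (f := action th) (ex_intro _ _ K0) Kc.
  apply: continuous_subspaceT.
  apply: (continuous_compose (f := fun v => (th, v)) action_continuous).
  by apply: continuous_pair; [exact: cst_continuous|move=> ?; exact: cvg_id].
exists v => w; have [wK|wK] := pselect (K w); first by apply: vmin; rewrite inE.
rewrite (le_trans (vmin 0 _)) ?inE//; apply: Hr.
have /existsNP[i Hi] := wK.
apply: (le_trans (ler_norm r)); apply: (le_trans _ (coord_le_enorm w i)).
by move/negP: Hi; rewrite in_itv/= -ler_norml -ltNge => /ltW.
Qed.

Lemma hamiltonian_ge p x v : - dotp p v - L x v <= hamiltonian L p x.
Proof.
have [w wmin] := action_argmin (p, x).
apply: ub_le_sup; last by exists v.
exists (- dotp p w - L x w) => _ /= [v' _ <-].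
by have := wmin v'; rewrite /action/=; lra.
Qed.

Lemma hamiltonian_argmin p x v : (forall w, action (p, x) v <= action (p, x) w) ->
  hamiltonian L p x = - dotp p v - L x v.
Proof.
move=> vmin; apply/eqP; rewrite eq_le hamiltonian_ge andbT.
apply: ge_sup; first by exists (- dotp p v - L x v); exists v.
by move=> _ /= [v' _ <-]; have := vmin v'; rewrite /action/=; lra.
Qed.

(** An envelope argument. Testing the supremum at [q = p + h e_i] with the minimiser for [p], and
    conversely, squeezes [H q - H p] between [- h v_i(p)] and [- h v_i(q)]; continuity of the
    minimiser then identifies the partial derivative. *)
Lemma hamiltonian_legendre : exists v : 'rV[R]_n * 'rV[R]_n -> 'rV[R]_n,
  [/\ continuous v,
      forall p x, hamiltonian L p x = - dotp p (v (p, x)) - L x (v (p, x))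
    & forall p x, - grad (fun q => hamiltonian L q x) p = v (p, x)].
Proof.
have [v vmin] := choice action_argmin.
have vc : continuous v.
  exact: (argmin_continuous action_continuous action_convex vmin).
have HE p x : hamiltonian L p x = - dotp p (v (p, x)) - L x (v (p, x)).
  by apply: hamiltonian_argmin => w; exact: vmin.
exists v; split => // p x; apply/rowP => i; rewrite !mxE; apply: oppr_inj; rewrite opprK.
rewrite /derive; apply: cvg_lim => //.
apply/cvgrPdist_le => /= e e0.
have vic : (fun h : R => v (h *: delta_mx 0 i + p, x) 0 i) @ 0^' --> v (p, x) 0 i.
  apply: cvg_within_filter.
  have : continuous (fun h : R => v (h *: delta_mx 0 i + p, x) 0 i).
    apply: (continuous_compose (f := fun h : R => v (h *: delta_mx 0 i + p, x))
      (@coord_continuous_rV R n i)).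
    apply: (continuous_compose (f := fun h : R => (h *: delta_mx 0 i + p, x)) vc).
    apply: continuous_pair; last by move=> ?; exact: cvg_cst.
    move=> h; apply: (@cvgD _ 'rV[R]_n); last exact: cvg_cst.
    by apply: (@cvgZr_tmp _ 'rV[R]_n); exact: cvg_id.
  by move=> /(_ 0); rewrite /continuous_at scale0r add0r.
move/cvgrPdist_le : vic => /(_ _ e0) vic.
near=> h.
have h0 : h != 0 by near: h; exact: nbhs_dnbhs_neq.
have : `|v (p, x) 0 i - v (h *: delta_mx 0 i + p, x) 0 i| <= e by near: h.
apply: le_trans; set q := h *: delta_mx 0 i + p.
have := hamiltonian_ge q x (v (p, x)); have := hamiltonian_ge p x (v (q, x)).
rewrite !HE /q !dotpDl !dotpZl !dotp_delta -/q.
set a := v (p, x) 0 i; set b := v (q, x) 0 i => H1 H2.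
rewrite -(ler_pM2l (x := `|h|)) ?normr_gt0// -!normrM.
rewrite /GRing.scale/= mulrBr mulrA mulfV// mul1r.
rewrite [leLHS]ler0_norm; last by lra.
by apply: le_trans (ler_norm _); lra.
Unshelve. all: by end_near.
Qed.

End legendre.

(** * Periodic functions and Taylor expansion *)

Section periodic_functions.
Variables (R : realType) (n : nat).
Implicit Types f g : 'rV[R]_n -> R.

Definition unit_cube : set 'rV[R]_n := [set x | forall i, `[0, 1]%classic (x ord0 i)].

Lemma unit_cube_compact : compact unit_cube.
Proof.
rewrite /unit_cube.
by apply: (@rV_compact R n (fun=> `[0, 1]%classic)) => _; exact: segment_compact.
Qed.

Lemma unit_cube_shift (x : 'rV[R]_n) : exists k : 'rV[int]_n, unit_cube (x + map_mx intr k).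
Proof.
exists (\row_i - Num.floor (x 0 i)) => i.
have := floor_le (x 0 i); have := floorD1_gt (x 0 i).
rewrite intrD /= !mxE in_itv/= mulrNz; lra.
Qed.

(* Unqualified, [periodic] would be the notion of mathcomp-analysis. *)
Lemma periodic_bounded f : Defs.periodic f -> continuous f ->
  exists M, 0 <= M /\ forall x, `|f x| <= M.
Proof.
move=> fper fc.
have cube0 : unit_cube !=set0 by have [k xk] := unit_cube_shift 0; exists (0 + map_mx intr k).
have nfc : continuous (fun x => `|f x|).
  exact: (continuous_compose (@norm_continuous R R) fc).
have [c _ cmax] := EVT_max_rV cube0 unit_cube_compact (continuous_subspaceT nfc).
exists `|f c|; split => // x; have [k xk] := unit_cube_shift x.
by rewrite -(fper x k); apply: cmax; rewrite inE.
Qed.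

(* The remainder bound [e + K |v|^2] stands for uniform continuity: it is a
   modulus that can be integrated against the fourth moment of the noise. *)
Lemma periodic_modulus f : Defs.periodic f -> continuous f -> forall e, 0 < e ->
  exists K, 0 <= K /\ forall x v, `|f (x + v) - f x| <= e + K * dotp v v.
Proof.
move=> fper fc e e0; have [M [M0 fM]] := periodic_bounded fper fc.
pose g (z : 'rV[R]_n * 'rV[R]_n) := f (z.1 + z.2) - f z.1.
have gc : continuous g.
  apply: continuous_sub; last exact: (continuous_compose fc (@continuous_fst _ _)).
  apply: (continuous_compose (f := fun z : 'rV[R]_n * 'rV[R]_n => z.1 + z.2) fc).
  by move=> z; apply: (@cvgD _ 'rV[R]_n); [exact: cvg_fst|exact: cvg_snd].
have : \forall v \near (0 : 'rV[R]_n), forall x, unit_cube x -> `|f (x + v) - f x| < e.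
  apply: ((compact_near_coveringP _).1 unit_cube_compact _ (nbhs (0 : 'rV[R]_n))
    (fun v x => `|f (x + v) - f x| < e)) => x _.
  have gx0 : g (x, 0) = 0 by rewrite /g/= addr0 subrr.
  have := gc (x, 0); rewrite /continuous_at gx0 => /cvgr0_norm_lt /(_ _ e0).
  move=> [-[A B] /= [nA nB] sAB].
  by exists (A, B) => // -[a b] /= [Aa Bb]; exact: (sAB (a, b) (conj Aa Bb)).
move=> /nbhs_ballP[d /= d0 Hd].
(* When [|v| >= d] the trivial bound [2 M] is at most this constant times [|v|^2]; when [|v| < d]
   the modulus [e] is enough. *)
exists (2 * M / d ^+ 2); split; first by apply: divr_ge0; [apply: mulr_ge0|apply: exprn_ge0; exact: ltW].
move=> x v; have vv0 : 0 <= dotp v v by apply: sumr_ge0 => i _; rewrite -expr2 sqr_ge0.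
have [vd|dv] := ltP `|v| d.
  have [k xk] := unit_cube_shift x.
  have := Hd v _ _ xk; rewrite addrAC !fper => H.
  rewrite (le_trans (ltW (H _)))//.
    by rewrite -ball_normE /ball_/= sub0r normrN.
  by rewrite lerDl mulr_ge0//; apply: divr_ge0; [apply: mulr_ge0|apply: exprn_ge0; exact: ltW].
have d2 : d ^+ 2 <= dotp v v.
  have : `|v| <= enorm v.
    have [->|] := eqVneq v 0; first by rewrite normr0 sqrtr_ge0.
    rewrite -normr_eq0 => /mx_norm_neq0[i vi].
    by rewrite [leLHS]vi (ord1 i.1) coord_le_enorm.
  move=> /(le_trans dv) dv'.
  by rewrite -[leRHS]sqr_sqrtr// ler_sqr ?nnegrE ?(ltW d0)// sqrtr_ge0.
rewrite (le_trans (ler_normB _ _))//.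
have h := fM (x + v); have h' := fM x.
have : 2 * M <= 2 * M / d ^+ 2 * dotp v v.
  by rewrite -mulrA ler_peMr ?mulr_ge0// mulrC ler_pdivlMr ?mul1r// exprn_gt0.
lra.
Qed.

Lemma periodic_derive f v : Defs.periodic f -> Defs.periodic ('D_v f).
Proof.
move=> fper x k; rewrite /derive.
by under eq_fun do rewrite /= addrA !fper.
Qed.

Lemma derive_coord f x v : differentiable f x ->
  'D_v f x = \sum_i v 0 i * 'D_(delta_mx 0 i) f x.
Proof.
move=> df; rewrite deriveE// [in LHS](row_sum_delta v) linear_sum.
by apply: eq_bigr => i _; rewrite linearZ/= deriveE.
Qed.

Lemma is_derive_line f (x v : 'rV[R]_n) (t : R) : differentiable f (t *: v + x) ->
  is_derive t 1 (fun s => f (s *: v + x)) ('D_v f (t *: v + x)).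
Proof.
move=> /(diff_derivable (v := v)); rewrite /derivable.
have E : (fun h : R => h^-1 *: (f (h *: v + (t *: v + x)) - f (t *: v + x)))
   = (fun h : R => h^-1 *: (((fun s => f (s *: v + x)) \o shift t) (h *: 1) - f (t *: v + x))).
  by apply/funext => h; rewrite /= [(h *: 1)]mulr1 scalerDl addrA.
move=> df; apply: DeriveDef; first by rewrite /derivable -E.
by rewrite /derive -E.
Qed.

Lemma Ck_sub (k : nat) f g : Ck k f -> Ck k g -> Ck k (fun x => f x - g x).
Proof.
elim: k f g => [|k IH] f g /= => [cf cg|[df cf] [dg cg]]; first exact: continuous_sub.
split=> [x|v]; first exact: differentiableB.
rewrite (_ : 'D_v _ = fun x => 'D_v f x - 'D_v g x); first by apply: IH.
by apply/funext => x; rewrite deriveB//; exact: diff_derivable.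
Qed.

End periodic_functions.

Section taylor.
Variables (R : realType) (n : nat).
Implicit Types (f : 'rV[R]_n -> R) (x v : 'rV[R]_n).

Definition partial f i : 'rV[R]_n -> R := 'D_(delta_mx 0 i) f.

Definition hessian_form f x v : R :=
  \sum_i \sum_j v 0 i * v 0 j * partial (partial f i) j x.

Lemma derive2_coord f x v : Ck 2 f -> 'D_v ('D_v f) x = hessian_form f x v.
Proof.
move=> [df d2f].
have -> : 'D_v f = \sum_i (fun y => v 0 i *: partial f i y).
  apply/funext => y; rewrite fct_sumE derive_coord//.
rewrite derive_sum; last first.
  by move=> i; apply: derivableZ; apply: diff_derivable; exact: (d2f _).1.
apply: eq_bigr => i _; rewrite deriveZ; last first.
  by apply: diff_derivable; exact: (d2f _).1.
rewrite derive_coord; last exact: (d2f _).1.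
by rewrite /GRing.scale/= big_distrr/=; apply: eq_bigr => j _; rewrite mulrA.
Qed.

Let taylor2_identity (a b p p' h h' c : R) :
  b - (p * 1 + 2^-1 * h * 1 ^+ 2) - (a - (p * 0 + 2^-1 * h * 0 ^+ 2)) =
    (p' - (p + h * c)) * (1 - 0) ->
  p' - p = h' * (c - 0) -> b = a + p + 2^-1 * h + c * (h' - h).
Proof. by move=> H1 H2; rewrite expr1n expr0n/= in H1; nra. Qed.

(** Two applications of the mean value theorem on the segment: to [f] minus its quadratic
    polynomial, with intermediate point [c], then to the first derivative on [[0, c]]. The factor
    [c] is not the sharp one, but later only [c <= 1] matters. *)
Lemma taylor2 f x v : Ck 2 f -> exists c s, [/\ 0 <= c <= 1, 0 <= s <= 1 &
  f (x + v) = f x + dotp (grad f x) v + 2^-1 * hessian_form f x v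
    + c * (hessian_form f (x + s *: v) v - hessian_form f x v)].
Proof.
move=> C2; have [df d2f] := C2.
pose phi (t : R) := f (t *: v + x); pose phi1 (t : R) := 'D_v f (t *: v + x).
pose phi2 (t : R) := hessian_form f (t *: v + x) v.
have d1 (t : R) : is_derive t 1 phi (phi1 t) by exact: is_derive_line.
have d2 (t : R) : is_derive t 1 phi1 (phi2 t).
  rewrite /phi2 -(derive2_coord _ _ C2).
  exact: (is_derive_line (f := 'D_v f) (proj1 (d2f v) _)).
have cont (g dg : R -> R) : (forall t : R, is_derive t 1 g (dg t)) -> continuous g.
  by move=> Hg t; apply: differentiable_continuous; apply/derivable1_diffP.
pose r t := phi t - (phi1 0 * t + 2^-1 * phi2 0 * t ^+ 2).
have dr (t : R) : is_derive t 1 r (phi1 t - (phi1 0 + phi2 0 * t)).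
  apply: is_deriveB; apply: is_derive_eq.
  by rewrite /GRing.scale/=; lra.
have [|c c01 Hc] := @MVT_segment R r _ 0 1 ler01 (fun t _ => dr t).
  by apply: continuous_subspaceT; exact: cont dr.
have c0 : 0 <= c by move: c01; rewrite in_itv/= => /andP[].
have [|s s0c Hs] := @MVT_segment R phi1 _ 0 c c0 (fun t _ => d2 t).
  by apply: continuous_subspaceT; exact: cont d2.
exists c, s; split.
- by move: c01; rewrite in_itv.
- by move: s0c c01; rewrite !in_itv/= => /andP[-> sc] /andP[_ /(le_trans sc)].
have -> : dotp (grad f x) v = phi1 0.
  rewrite /phi1 scale0r add0r derive_coord// /dotp; apply: eq_bigr => i _.
  by rewrite !mxE mulrC.
move: Hc; rewrite /r /phi !scale1r !scale0r add0r (addrC v).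
move: Hs; rewrite /phi2 scale0r add0r (addrC _ x) => Hs Hc.
exact: (taylor2_identity Hc Hs).
Qed.

Lemma dotp_ge0 v : 0 <= dotp v v.
Proof. by apply: sumr_ge0 => i _; rewrite -expr2 sqr_ge0. Qed.

Lemma mul_coord_le v i j : `|v 0 i * v 0 j| <= dotp v v.
Proof.
rewrite normrM -[leRHS]sqr_sqrtr ?dotp_ge0// expr2.
by rewrite ler_pM// coord_le_enorm.
Qed.

Lemma partial_continuous f i : Ck 2 f -> continuous (partial f i).
Proof.
by move=> [_ d2f] x; apply: differentiable_continuous; exact: (proj1 (d2f _)).
Qed.

Lemma partial2_continuous f i j : Ck 2 f -> continuous (partial (partial f i) j).
Proof. by move=> [_ d2f]; exact: (proj2 (d2f _) _). Qed.

Lemma partial2_periodic f i j :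
  Defs.periodic f -> Defs.periodic (partial (partial f i) j).
Proof. by move=> fper; do 2 apply: periodic_derive. Qed.

Lemma hessian_modulus f e : Ck 2 f -> Defs.periodic f -> 0 < e ->
  exists K, 0 <= K /\ forall x v s, 0 <= s <= 1 ->
  `|hessian_form f (x + s *: v) v - hessian_form f x v| <=
  (e + K * dotp v v) * dotp v v.
Proof.
(* The tolerance is shared by the [n * n] entries of the Hessian; the successor avoids a zero
   denominator when [n = 0]. *)
move=> C2 fper e0; pose e1 := e / (n * n).+1%:R.
have e10 : 0 < e1 by rewrite divr_gt0.
have /choice[K KP] (ij : 'I_n * 'I_n) : exists K, 0 <= K /\ forall x v,
    `|partial (partial f ij.1) ij.2 (x + v) - partial (partial f ij.1) ij.2 x| <=
    e1 + K * dotp v v.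
  exact: (periodic_modulus (@partial2_periodic f ij.1 ij.2 fper)
    (@partial2_continuous f ij.1 ij.2 C2) e10).
pose K1 := \sum_ij K ij.
have K10 : 0 <= K1 by apply: sumr_ge0 => ij _; have [] := KP ij.
have KK1 ij : K ij <= K1.
  by rewrite /K1 (bigD1 ij)//= lerDl sumr_ge0// => ? _; exact: (KP _).1.
exists ((n * n)%:R * K1); split; first by rewrite mulr_ge0.
move=> x v s /andP[s0 s1]; rewrite /hessian_form -sumrB.
have D0 := dotp_ge0 v.
have term i j : `|v 0 i * v 0 j * partial (partial f i) j (x + s *: v) -
    v 0 i * v 0 j * partial (partial f i) j x| <= dotp v v * (e1 + K1 * dotp v v).
  rewrite -mulrBr normrM ler_pM ?mul_coord_le//.
  have [K0 /(_ x (s *: v))] := KP (i, j); move/le_trans; apply.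
  rewrite lerD2l dotpZl dotpZr mulrA.
  have ss : s * s <= 1 by nra.
  have := KK1 (i, j) => KK.
  by rewrite ler_pM// ?ler_piMl ?mulr_ge0.
apply: (@le_trans _ _ (\sum_(i < n) \sum_(j < n) dotp v v * (e1 + K1 * dotp v v))).
  apply: (le_trans (ler_norm_sum _ _ _)); apply: ler_sum => i _.
  rewrite -sumrB; apply: (le_trans (ler_norm_sum _ _ _)); apply: ler_sum => j _.
  exact: term.
rewrite !sumr_const !card_ord -mulrnA -[leLHS]mulr_natr.
have : e1 * (n * n)%:R <= e.
  by rewrite /e1 mulrAC ler_pdivrMr// ler_wpM2l ?(ltW e0)// ler_nat leqnSn.
move: (n * n)%:R (dotp v v) D0 => N D D0 e1e.
have -> : D * (e1 + K1 * D) * N = (e1 * N + N * K1 * D) * D by ring.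
by rewrite ler_wpM2r// lerD2r.
Qed.

Lemma taylor2_bound f e : Ck 2 f -> Defs.periodic f -> 0 < e ->
  exists K, 0 <= K /\ forall x v,
  `|f (x + v) - (f x + dotp (grad f x) v + 2^-1 * hessian_form f x v)| <=
  (e + K * dotp v v) * dotp v v.
Proof.
move=> C2 fper e0; have [K [K0 KP]] := hessian_modulus C2 fper e0.
exists K; split => // x v; have [c [s [/andP[c0 c1] s01 ->]]] := taylor2 x v C2.
rewrite addrAC subrr add0r normrM ger0_norm//.
by rewrite (le_trans _ (KP x v s s01))// ler_piMl.
Qed.

End taylor.

(** * Moments of the normal law *)

Section density.
Local Open Scope ereal_scope.
Context d (T : measurableType d) (R : realType).
Variables (mu nu : {measure set T -> \bar R}) (p : T -> R).
Hypotheses (mp : measurable_fun setT p) (p0 : forall x, (0 <= p x)%R).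
Hypothesis nuE : forall A, measurable A -> nu A = \int[mu]_(x in A) (p x)%:E.

Import HBNNSimple.

Let density_nnsfun (f : {nnsfun T >-> R}) :
  \int[nu]_x (f x)%:E = \int[mu]_x (f x * p x)%:E.
Proof.
under eq_integral do rewrite fimfunE -fsumEFin//.
rewrite ge0_integral_fsum//; last 2 first.
  - by move=> r; exact/measurable_EFinP/measurableT_comp.
  - by move=> n x _; rewrite EFinM nnfun_muleindic_ge0.
under [RHS]eq_integral.
  move=> x _; rewrite EFinM fimfunE -fsumEFin// muleC ge0_mule_fsumr; last first.
    by move=> r; rewrite EFinM nnfun_muleindic_ge0.
  over.
rewrite [RHS]ge0_integral_fsum//; last 2 first.
  - move=> r; apply/measurable_EFinP; apply: measurable_funM => //.
    by apply: measurable_funM => //; exact: measurable_indic.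
  - move=> n x _; apply: mule_ge0; first by rewrite lee_fin.
    by rewrite EFinM nnfun_muleindic_ge0.
apply: eq_fsbigr => r _.
under eq_integral do rewrite EFinM.
under [RHS]eq_integral do rewrite EFinM muleCA.
have mfr : measurable (f @^-1` [set r]) by exact: measurable_sfunP.
have [r0|r0] := leP 0%R r; last first.
  have f0 x : \1_(f @^-1` [set r]) x = 0%R :> R.
    rewrite indicE; apply/eqP; rewrite pnatr_eq0 eqb0; apply/negP; rewrite inE/=.
    by move=> fxr; move: r0; rewrite -fxr ltNge fun_ge0.
  by rewrite !integral0_eq// => x _; rewrite f0 ?mule0.
rewrite ge0_integralZl//; last exact/measurable_EFinP/measurable_indic.
rewrite ge0_integralZl//; last 2 first.
  - apply/measurable_EFinP; apply: measurable_funM => //; exact: measurable_indic.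
  - by move=> x _; rewrite -EFinM lee_fin mulr_ge0.
congr (_ * _); rewrite integral_indic// setIT nuE// integral_mkcond.
apply: eq_integral => x _; rewrite patchE indicE.
by case: ifPn => _; rewrite ?mule1 ?mule0.
Qed.

(** Indicators are the hypothesis [nuE], simple functions follow by linearity, and [f] by monotone
    convergence. *)
Lemma ge0_integral_density (f : T -> R) :
  measurable_fun setT f -> (forall x, (0 <= f x)%R) ->
  \int[nu]_x (f x)%:E = \int[mu]_x (f x * p x)%:E.
Proof.
move=> mf f0; have mf' : measurable_fun setT (EFin \o f) by exact/measurable_EFinP.
pose f_ := nnsfun_approx measurableT mf'.
have cvgf x : (f_ n x)%:E @[n --> \oo] --> (f x)%:E.
  by apply: (cvg_nnsfun_approx measurableT mf') => //= y _; rewrite lee_fin.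
transitivity (lim (\int[nu]_x (f_ n x)%:E @[n --> \oo])).
  rewrite -monotone_convergence//=.
  - by apply: eq_integral => x _; apply/esym/cvg_lim => //; exact: cvgf.
  - by move=> n; exact/measurable_EFinP/measurable_funTS.
  - by move=> n x _; rewrite lee_fin.
  - by move=> x _ a b ab; rewrite lee_fin; exact/lefP/nd_nnsfun_approx.
transitivity (lim (\int[mu]_x (f_ n x * p x)%:E @[n --> \oo])).
  by congr (lim _); apply/funext => A; under eq_fun do rewrite density_nnsfun.
rewrite -monotone_convergence//=.
- apply: eq_integral => x _; apply/cvg_lim => //.
  under eq_fun do rewrite EFinM muleC; rewrite EFinM muleC.
  by apply: cvgeZl => //; exact: cvgf.
- by move=> n; apply/measurable_EFinP/measurable_funM.
- by move=> n x _; rewrite lee_fin mulr_ge0.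
- move=> x _ a b ab; rewrite lee_fin ler_wpM2r//.
  exact/lefP/nd_nnsfun_approx.
Qed.

End density.

Section normal_moments.
Variables (R : realType) (s : R).
Hypothesis s0 : 0 < s.
Let nu := normal_prob 0 s.

(* [expR (tilt m r)] is, up to the factor [r], the density of N(m, (r s)^2) with
   respect to N(0, s^2). As it dominates its tangent lines, varying [m] and [r]
   around [0] and [1] yields the first two moments. *)
Let tilt (m r x : R) := x ^+ 2 / (s ^+ 2 *+ 2) - (x - m) ^+ 2 / ((r * s) ^+ 2 *+ 2).

Lemma normal_pdf_tilt m r x : 0 < r ->
  expR (tilt m r x) * normal_pdf 0 s x = r * normal_pdf m (r * s) x.
Proof.
move=> r0; rewrite !normal_pdfE ?gt_eqF ?mulr_gt0//.
rewrite mulrCA -expRD mulrA; congr (_ * _).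
  rewrite /normal_peak.
  have -> : (r * s) ^+ 2 * pi *+ 2 = r ^+ 2 * (s ^+ 2 * pi *+ 2) by ring.
  rewrite (sqrtrM _ (sqr_ge0 r)) sqrtr_sqr gtr0_norm//.
  by rewrite invfM mulrA mulfV ?gt_eqF// mul1r.
by rewrite /normal_fun subr0; congr expR; rewrite /tilt; ring.
Qed.

Let measurable_tilt m r : measurable_fun setT (fun x => expR (tilt m r x)).
Proof.
apply: measurableT_comp => //; apply: measurable_funB; apply: measurable_funM => //.
by apply: measurable_funX; exact: measurable_funB.
Qed.

Lemma integral_tilt m r : 0 < r ->
  (\int[nu]_x (expR (tilt m r x))%:E = r%:E)%E.
Proof.
move=> r0; have rs0 : r * s != 0 by rewrite gt_eqF ?mulr_gt0.
rewrite (@ge0_integral_density _ _ R lebesgue_measure nu (normal_pdf 0 s)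
  (measurable_normal_pdf 0 s) (normal_pdf_ge0 0 s) _ _ (measurable_tilt m r)
  (fun x => expR_ge0 _))//.
under eq_integral do rewrite normal_pdf_tilt// EFinM.
rewrite ge0_integralZl//.
- by rewrite integral_normal_pdf mule1.
- by apply/measurable_EFinP; exact: measurable_normal_pdf.
- by move=> x _; rewrite lee_fin normal_pdf_ge0.
- by rewrite lee_fin ltW.
Qed.

Lemma integrable_tilt m r : 0 < r ->
  nu.-integrable setT (EFin \o (fun x => expR (tilt m r x))).
Proof.
move=> r0; apply/integrableP; split; first by apply/measurable_EFinP; exact: measurable_tilt.
under eq_integral do rewrite /= ger0_norm ?expR_ge0//.
by rewrite integral_tilt// ltry.
Qed.

Lemma tilt_bound m r (g : R -> R) : 0 < r -> measurable_fun setT g ->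
  (forall x, g x <= expR (tilt m r x)) -> nu.-integrable setT (EFin \o g) ->
  \int[nu]_x g x <= r.
Proof.
move=> r0 mg gle ig; rewrite -lee_fin -(integral_tilt m r0) /Rintegral fineK; last first.
  exact: integrable_fin_num.
by apply: le_integral => //; [exact: integrable_tilt|move=> x _; rewrite lee_fin].
Qed.

(** For [m = 0] and [r = 2] the exponent is [u = 3 x^2 / (8 s^2)], and [exp u >= (1 + u/2)^2 >=
    (u/2)^2 = 9 x^4 / (256 s^4)]. The left side has integral 2, so the moment is at most
    [512/9 s^4], rounded up to [57 s^4]. Only the order [s^4] matters; the exact value is
    [3 s^4]. *)
Lemma normal_moment4 : nu.-integrable setT (EFin \o (fun x => x ^+ 4)) /\
  \int[nu]_x (x ^+ 4) <= 57 * s ^+ 4.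
Proof.
have m4 : measurable_fun setT (fun x : R => x ^+ 4) by exact: measurable_funX.
have le4 (x : R) : 9 / 256 / s ^+ 4 * x ^+ 4 <= expR (tilt 0 2 x).
  set u := tilt 0 2 x.
  have uE : u = 3 / 8 / s ^+ 2 * x ^+ 2.
    by rewrite /u /tilt; field; rewrite gt_eqF.
  have u0 : 0 <= u by rewrite uE mulr_ge0 ?sqr_ge0// divr_ge0// sqr_ge0.
  have -> : 9 / 256 / s ^+ 4 * x ^+ 4 = (u / 2) ^+ 2.
    by rewrite uE; field; rewrite gt_eqF.
  have -> : expR u = expR (u / 2) ^+ 2 by rewrite -expRM_natl; congr expR; field.
  rewrite ler_sqr ?nnegrE ?expR_ge0 ?divr_ge0//.
  by rewrite (le_trans _ (expR_ge1Dx _))// lerDr.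
have two0 : 0 < 2 :> R by [].
have k0 : 0 < 9 / 256 / s ^+ 4.
  by apply: divr_gt0 (exprn_gt0 4 s0); lra.
have i4 : nu.-integrable setT (EFin \o (fun x => x ^+ 4)).
  have ik := integrableZl measurableT (9 / 256 / s ^+ 4)^-1 (@integrable_tilt 0 2 two0).
  apply: (le_integrable _ _ _ ik) => //; first exact/measurable_EFinP.
  move=> x _; rewrite /= lee_fin [leLHS]ger0_norm ?exprn_even_ge0//.
  rewrite (le_trans _ (ler_norm _))// mulrC ler_pdivlMr// mulrC; exact: le4.
split=> //.
have ik4 : nu.-integrable setT (EFin \o (fun x => 9 / 256 / s ^+ 4 * x ^+ 4)).
  by have := integrableZl measurableT (9 / 256 / s ^+ 4) i4.
have mk4 : measurable_fun setT (fun x : R => 9 / 256 / s ^+ 4 * x ^+ 4).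
  exact: measurable_funM.
have := tilt_bound two0 mk4 le4 ik4.
rewrite RintegralZl// mulrC -ler_pdivlMr// => /le_trans; apply.
have -> : 2 / (9 / 256 / s ^+ 4) = 512 / 9 * s ^+ 4 by field; rewrite gt_eqF.
by rewrite ler_pM2r ?exprn_gt0//; lra.
Qed.

Let integrable_cst (k : R) : nu.-integrable setT (EFin \o cst k).
Proof. exact: finite_measure_integrable_cst. Qed.

Lemma normal_integrable_le (g : R -> R) : measurable_fun setT g ->
  (forall x, `|g x| <= 1 + x ^+ 4) -> nu.-integrable setT (EFin \o g).
Proof.
move=> mg gle; apply: (@le_integrable _ _ _ nu _ _ _ (EFin \o (fun x => 1 + x ^+ 4))) => //.
- exact/measurable_EFinP.
- by move=> x _; rewrite lee_fin (le_trans (gle x))// ler_norm.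
exact: (integrableD measurableT (integrable_cst 1) normal_moment4.1).
Qed.

Lemma normal_integrable1 : nu.-integrable setT (EFin \o id).
Proof.
apply: normal_integrable_le => //= x.
have : `|x| ^+ 4 = x ^+ 4 by rewrite -normrX ger0_norm// exprn_even_ge0.
have := normr_ge0 x; move: (`|x|) => y y0 <-.
have : 0 <= (y ^+ 2 - 2^-1) ^+ 2 + (y - 2^-1) ^+ 2 by rewrite addr_ge0 ?sqr_ge0.
nra.
Qed.

Lemma normal_integrable2 : nu.-integrable setT (EFin \o (fun x => x ^+ 2)).
Proof.
apply: normal_integrable_le => // x.
by rewrite ger0_norm ?sqr_ge0//; have := sqr_ge0 (x ^+ 2 - 1); nra.
Qed.

(** The shift [m] is taken to be the unknown mean [m1] itself. The tangent [1 + tilt m1 1 x] is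
    affine in [x], and its integral [1 + m1^2 / (2 s^2)] cannot exceed 1. *)
Lemma normal_moment1 : \int[nu]_x x = 0.
Proof.
set m1 := \int[nu]_x x.
pose g (x : R) := m1 / s ^+ 2 * x + (1 - m1 ^+ 2 / (s ^+ 2 *+ 2)).
have mg : measurable_fun setT g by apply: measurable_funD => //; exact: measurable_funM.
have i1 : nu.-integrable setT (EFin \o (fun x => m1 / s ^+ 2 * x)).
  exact: (integrableZl measurableT _ normal_integrable1).
have i2 := integrable_cst (1 - m1 ^+ 2 / (s ^+ 2 *+ 2)).
have gle x : g x <= expR (tilt m1 1 x).
  rewrite (le_trans _ (expR_ge1Dx _))// /g /tilt mul1r.
  rewrite le_eqVlt; apply/orP; left; apply/eqP; field; rewrite gt_eqF//.
have := tilt_bound ltr01 mg gle (integrableD measurableT i1 i2).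
rewrite /g RintegralD// RintegralZl//; last exact: normal_integrable1.
rewrite Rintegral_cst// -/m1 [X in fine X]probability_setT mulr1.
rewrite [X in X <= _ -> _](_ : _ = 1 + m1 ^+ 2 / (s ^+ 2 *+ 2)); last first.
  by field; rewrite gt_eqF.
rewrite gerDl => H; apply/eqP; rewrite -sqrf_eq0 eq_le sqr_ge0 andbT.
by move: H; rewrite ler_pdivrMr ?mul0r// pmulrn_lgt0// exprn_gt0.
Qed.

(** With [m = 0] the tangent bound, multiplied by [r^2], is [A (r^2 - 1) <= r^2 (r - 1)], an
    equality at [r = 1]. Comparing slopes there, [r > 1] gives [2 A <= 1] and [r < 1] gives
    [2 A >= 1]. *)
Lemma normal_moment2 : \int[nu]_x (x ^+ 2) = s ^+ 2.
Proof.
set m2 := \int[nu]_x (x ^+ 2); pose A := m2 / (s ^+ 2 *+ 2).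
have H r : 0 < r -> A * (r ^+ 2 - 1) <= r ^+ 2 * (r - 1).
  move=> r0; pose k := (1 - r ^- 2) / (s ^+ 2 *+ 2).
  pose g (x : R) := k * x ^+ 2 + 1.
  have mg : measurable_fun setT g.
    by apply: measurable_funD => //; apply: measurable_funM => //; exact: measurable_funX.
  have i1 : nu.-integrable setT (EFin \o (fun x => k * x ^+ 2)).
    exact: (integrableZl measurableT _ normal_integrable2).
  have i2 := integrable_cst 1.
  have gle x : g x <= expR (tilt 0 r x).
    rewrite (le_trans _ (expR_ge1Dx _))// /g addrC lerD2l /tilt subr0 /k.
    rewrite le_eqVlt; apply/orP; left; apply/eqP; field; rewrite !gt_eqF//.
  have := tilt_bound r0 mg gle (integrableD measurableT i1 i2).
  rewrite /g RintegralD// RintegralZl//; last exact: normal_integrable2.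
  rewrite Rintegral_cst// -/m2 [X in fine X]probability_setT mulr1 => Hk.
  have : r ^+ 2 * (k * m2 + 1) <= r ^+ 2 * r by rewrite ler_wpM2l// sqr_ge0.
  have -> : r ^+ 2 * (k * m2 + 1) = A * (r ^+ 2 - 1) + r ^+ 2.
    by rewrite /k /A; field; rewrite !gt_eqF.
  by rewrite mulrBr mulr1; lra.
have A0 : 0 <= A.
  rewrite divr_ge0 ?pmulrn_lge0 ?sqr_ge0//.
  by apply: Rintegral_ge0 => x _; exact: sqr_ge0.
have A2 : A = 2^-1.
  apply/eqP; rewrite eq_le; apply/andP; split; rewrite leNgt; apply/negP => HA.
  (* If [2 A > 1], this [e] is small enough for [A (2 + e)] to exceed [1 + 2 e + e^2], against the
     inequality at [r = 1 + e]. *)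
  - pose e := Num.min 1 ((2 * A - 1) / 4).
    have e0 : 0 < e by rewrite lt_min ltr01/= divr_gt0//; lra.
    have [e1 e2] : e <= 1 /\ e <= (2 * A - 1) / 4 by rewrite !ge_min !lexx orbT.
    have /H : 0 < 1 + e by lra.
    have -> : A * ((1 + e) ^+ 2 - 1) = e * (A * (2 + e)) by ring.
    have -> : (1 + e) ^+ 2 * (1 + e - 1) = e * (1 + 2 * e + e ^+ 2) by ring.
    rewrite ler_pM2l//; nra.
  - pose e := (1 - 2 * A) / 4.
    have e0 : 0 < e by rewrite divr_gt0//; lra.
    have e1 : e <= 1 / 4 by rewrite ler_pM2r; lra.
    have /H : 0 < 1 - e by lra.
    have -> : A * ((1 - e) ^+ 2 - 1) = - (e * (A * (2 - e))) by ring.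
    have -> : (1 - e) ^+ 2 * (1 - e - 1) = - (e * (1 - 2 * e + e ^+ 2)) by ring.
    rewrite lerN2 ler_pM2l// /e; nra.
have : m2 = A * (s ^+ 2 *+ 2) by rewrite /A divfK// gt_eqF// pmulrn_lgt0// exprn_gt0.
by rewrite A2 => ->; rewrite mulrnAr -mulr_natr mulrAC mulVf ?mul1r.
Qed.

End normal_moments.

(** * Independence *)

Section independence.
Context d (T : measurableType d) (R : realType) (Pr : probability T R).
Implicit Types (X Y : T -> R) (nu : probability (measurableTypeR R) R).

(* The case [A = setT] says that [nu] is the law of [Y]. *)
Definition indep_law X Y nu := forall A B : set R, measurable A -> measurable B ->
  Pr (X @^-1` A `&` Y @^-1` B) = (Pr (X @^-1` A) * nu B)%E.

(** The joint law of [(X, Y)] agrees with the product measure on rectangles, hence everywhere, and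
    Fubini splits the integral. *)
Lemma indep_expectation X Y nu (f : R -> R) :
  measurable_fun setT X -> measurable_fun setT Y -> measurable_fun setT f ->
  indep_law X Y nu ->
  Pr.-integrable setT (EFin \o X) -> nu.-integrable setT (EFin \o f) ->
  Pr.-integrable setT (EFin \o (fun w => X w * f (Y w))) /\
  \int[Pr]_w (X w * f (Y w)) = \int[Pr]_w X w * \int[nu]_y f y.
Proof.
move=> mX mY mf XY iX jf.
pose X' : {RV Pr >-> R} := mfun_Sub (mem_set mX).
pose XYf (w : T) : R * measurableTypeR R := (X w, Y w).
have mXY : measurable_fun setT XYf by exact: measurable_fun_pair.
pose m1 := distribution Pr X'.
pose XY' : {RV Pr >-> (R * measurableTypeR R)%type} := mfun_Sub (mem_set mXY).
pose m' := distribution Pr XY'.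
pose h (z : R * measurableTypeR R) : \bar R := (z.1 * f z.2)%:E.
have mh : measurable_fun setT h.
  apply/measurable_EFinP; apply: measurable_funM; first exact: measurable_fst.
  exact: (measurableT_comp mf measurable_snd).
have iX1 : m1.-integrable setT (EFin \o id).
  exact: (integrable_pushforward _ _ iX).
have E C : measurable C -> (m1 \x nu)%E C = m' C.
  move=> mC. have H := @product_measure_unique _ _ _ _ R m1 nu m'.
  exact: H.
have mnf : measurable_fun setT (fun y : R => `|f y|%:E).
  by apply/measurable_EFinP; apply: measurableT_comp => //.
have mnx : measurable_fun setT (fun x : R => `|x|%:E).
  apply/measurable_EFinP; apply: measurableT_comp; [exact: normr_measurable|exact: measurable_id].
have /integrableP[_ nf_fin] := jf; have /integrableP[_ nx_fin] := iX1.
have ih : (m1 \x nu)%E.-integrable setT h.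
  apply/integrable12ltyP => //.
  under eq_integral.
    move=> x _; rewrite /h/=.
    under eq_integral do rewrite normrM EFinM.
    rewrite ge0_integralZl//.
    over.
  have nf0 : (0 <= \int[nu]_y `|f y|%:E)%E by apply: integral_ge0 => y _; rewrite lee_fin.
  rewrite ge0_integralZr//.
  apply: lte_mul_pinfty => //.
    by apply: integral_ge0 => y _; rewrite lee_fin.
  by rewrite ge0_fin_numE//; apply: integral_ge0 => y _; rewrite lee_fin.
have intE : (\int[m1 \x nu]_z h z = \int[m1]_x x%:E * \int[nu]_y (f y)%:E)%E.
  rewrite -integral12_prod_meas1//.
  transitivity (\int[m1]_x (x%:E * \int[nu]_y (f y)%:E))%E.
    by apply: eq_integral => x _; rewrite -integralZl.
  have /fineK <- : (\int[nu]_y (f y)%:E)%E \is a fin_num by exact: integrable_fin_num.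
  by rewrite integralZr.
have nhE : (\int[m1 \x nu]_z `|h z| = \int[Pr]_w `|h (XYf w)|)%E.
  rewrite (eq_measure_integral m' (fun A mA _ => E A mA)).
  by rewrite ge0_integral_distribution//; exact: measurableT_comp.
have ihP : Pr.-integrable setT (h \o XYf).
  apply/integrableP; split; first exact: measurableT_comp.
  by rewrite -nhE; have /integrableP[] := ih.
split; first exact: ihP.
have E1 : (\int[m']_z h z = \int[Pr]_w (X w * f (Y w))%:E)%E.
  exact: (integral_distribution (X := XY') mh ihP).
have E2 : (\int[m1]_x x%:E = \int[Pr]_w (X w)%:E)%E.
  have mid : measurable_fun setT (EFin \o @id R) by apply/measurable_EFinP; exact: measurable_id.
  exact: (integral_distribution (X := X') mid iX).
have E3 : (\int[m1 \x nu]_z h z = \int[m']_z h z)%E.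
  exact: (eq_measure_integral m' (fun A mA _ => E A mA)).
by rewrite /Rintegral -E1 -E3 intE E2 fineM//; exact: integrable_fin_num.
Qed.

(** For a fixed [C], the law of [(X, Y)] conditioned on [Z] in [C] is the product measure on
    rectangles, hence on all measurable sets, in particular on the inverse image of [A] under
    multiplication. This serves the mixed products of two coordinates of the noise. *)
Lemma indep_law_mul X Y Z (nu1 nu2 : probability (measurableTypeR R) R) :
  measurable_fun setT X -> measurable_fun setT Y -> measurable_fun setT Z ->
  (forall A B C : set R, measurable A -> measurable B -> measurable C ->
    Pr (X @^-1` A `&` Y @^-1` B `&` Z @^-1` C) =
      (Pr (X @^-1` A) * (nu1 B * nu2 C))%E) ->
  indep_law (fun w => X w * Y w) Z nu2.
Proof.
move=> mX mY mZ H A C mA mC.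
have nuT (nu : probability (measurableTypeR R) R) : nu setT = 1%E by exact: probability_setT.
have HC B B' : measurable B -> measurable B' ->
    Pr (X @^-1` B `&` Y @^-1` B') = (Pr (X @^-1` B) * nu1 B')%E.
  move=> mB mB'; have := H B B' setT mB mB' measurableT.
  by rewrite preimage_setT setIT nuT mule1.
pose X' : {RV Pr >-> R} := mfun_Sub (mem_set mX).
pose XYf (w : T) : R * measurableTypeR R := (X w, Y w).
have mXY : measurable_fun setT XYf by exact: measurable_fun_pair.
pose m1 := distribution Pr X'.
pose D := Z @^-1` C.
have mD : measurable D by rewrite -[D]setTI; exact: mZ.
have mA' : measurable ((fun z : R * measurableTypeR R => z.1 * z.2) @^-1` A).
  rewrite -[X in measurable X]setTI.
  have : measurable_fun setT (fun z : R * measurableTypeR R => z.1 * z.2).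
    by apply: measurable_funM; [exact: measurable_fst|exact: measurable_snd].
  by move=> /(_ measurableT A mA).
pose XY' : {RV Pr >-> (R * measurableTypeR R)%type} := mfun_Sub (mem_set mXY).
have E1 E : measurable E -> (m1 \x nu1)%E E = distribution Pr XY' E.
  move=> mE; have U := @product_measure_unique _ _ _ _ R m1 nu1 (distribution Pr XY').
  by apply: U => // B B' mB mB'; exact: HC.
have mXYA : measurable ((fun w => X w * Y w) @^-1` A).
  by rewrite -[Q in measurable Q]setTI; exact: (measurable_funM mX mY).
have cfin : nu2 C \is a fin_num by exact: fin_num_measure.
(* Conditioning divides by [nu2 C]. If this vanishes, both sides are zero because the event lies in
   the null set [D]. *)
have [c0|c0] := eqVneq (nu2 C) 0%E.
  rewrite c0 mule0; apply/eqP; rewrite eq_le measure_ge0 andbT.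
  have <- : Pr D = 0%E.
    have := H setT setT C measurableT measurableT mC.
    by rewrite !preimage_setT !setTI c0 !mule0.
  apply: le_measure; rewrite ?inE//.
  exact: measurableI.
have c1 : (0 < fine (nu2 C))%R.
  by rewrite fine_gt0// lt0e c0 measure_ge0/= -ge0_fin_numE// measure_ge0.
have k0 : 0 <= (fine (nu2 C))^-1 by rewrite invr_ge0 ltW.
(* The measure structure of a pushforward depends on a measurability proof that
   unification cannot find, hence the explicit instance. *)
pose m' := mscale (NngNum k0)
  (measure_function_pushforward__canonical__measure_function_Measure (mrestr Pr mD) mXY).
have kC : ((fine (nu2 C))^-1%:E * nu2 C = 1)%E.
  by rewrite -[X in (_ * X)%E](fineK cfin) -EFinM mulVf// gt_eqF.
have E2 E : measurable E -> (m1 \x nu1)%E E = m' E.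
  move=> mE; have U := @product_measure_unique _ _ _ _ R m1 nu1 m'.
  apply: U => // B B' mB mB'; rewrite /m' /mscale/= /mrestr.
  by rewrite [Q in (_ * Q = _)%E](H B B' C mB mB' mC) muleCA (muleCA _ (nu1 B')) kC mule1.
have := E2 _ mA'; rewrite (E1 _ mA') /m' /mscale/= /pushforward /mrestr => E3.
rewrite [X in (_ = X * _)%E]E3 -muleA (muleC _ (nu2 C)) muleA kC mul1e.
by [].
Qed.

End independence.

(** * Continuous functions of random vectors *)

Section measurable_vector.
Variables (R : realType) (n : nat).

Let grid (k : nat) (x : 'rV[R]_n) : 'rV[int]_n := \row_i Num.floor (k.+1%:R * x 0 i).

Lemma rV_norm_le (x : 'rV[R]_n) (e : R) : 0 <= e ->
  (forall i, `|x 0 i| <= e) -> `|x| <= e.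
Proof.
move=> e0 xe; have [->|] := eqVneq x 0; first by rewrite normr0.
rewrite -normr_eq0 => /mx_norm_neq0[i xi].
by rewrite [leLHS]xi (ord1 i.1); exact: xe.
Qed.

Let grid_bounds (k : nat) (x : 'rV[R]_n) i :
  (grid k x 0 i)%:~R <= k.+1%:R * x 0 i < (grid k x 0 i)%:~R + 1.
Proof. by rewrite mxE floor_le/= -intrD1 floorD1_gt. Qed.

Let grid_cvg (x : 'rV[R]_n) :
  (k.+1%:R^-1 *: map_mx intr (grid k x) : 'rV[R]_n) @[k --> \oo] --> x.
Proof.
apply/cvgrPdist_le => /= e e0.
have := near_infty_natSinv_lt (PosNum e0); apply: filterS => k /= ke.
apply: le_trans (ltW ke); apply: rV_norm_le => [|i]; first by rewrite invr_ge0.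
move: (grid k x) (grid_bounds k x i) => m; rewrite !mxE.
move: (m 0 i)%:~R (x 0 i) => a b ab.
have k0 : 0 < k.+1%:R :> R by [].
have -> : b - k.+1%:R^-1 * a = k.+1%:R^-1 * (k.+1%:R * b - a).
  by rewrite mulrBr mulKf ?gt_eqF.
rewrite normrM ger0_norm ?invr_ge0// ler_piMr ?invr_ge0// ler_norml; lra.
Qed.

(** Rounding [X] down to a grid of mesh [1/(k+1)] leaves countably many values, each taken on a
    measurable box event, so [g] of the rounded vector is measurable; by continuity these functions
    converge to [g \o X]. The source is an arbitrary measurable space so that it can carry the
    sigma-algebra [F t]. *)
Lemma measurable_continuous_comp d (S : measurableType d) (X : S -> 'rV[R]_n)
    (g : 'rV[R]_n -> R) :
  (forall i, measurable_fun setT (fun w => X w 0 i)) -> continuous g ->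
  measurable_fun setT (g \o X).
Proof.
move=> mX cg.
pose h (k : nat) (w : S) := g (k.+1%:R^-1 *: map_mx intr (grid k (X w))).
apply: (@measurable_fun_cvg _ _ _ _ h) => [k|w _].
  move=> _ B mB; rewrite setTI.
  pose E (m : 'rV[int]_n) : set S := [set w | forall i,
    (fun w => X w 0 i) w \in `[(m 0 i)%:~R / k.+1%:R, ((m 0 i)%:~R + 1) / k.+1%:R[%R].
  pose V (j : nat) : set S := if @unpickle 'rV[int]_n j is Some m
    then if `[< B (g (k.+1%:R^-1 *: map_mx intr m)) >] then E m else set0 else set0.
  have mE m : measurable (E m).
    rewrite (_ : E m = \bigcap_(i in [set: 'I_n])
      ((fun w => X w 0 i) @^-1` `[(m 0 i)%:~R / k.+1%:R, ((m 0 i)%:~R + 1) / k.+1%:R[%classic)).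
      apply: fin_bigcap_measurable => // i _; rewrite -[Q in measurable Q]setTI.
      exact: (mX i measurableT).
    by apply/seteqP; split => w Ew i; [move=> _; exact: Ew|exact: (Ew i I)].
  rewrite (_ : _ @^-1` _ = \bigcup_j V j).
    apply: bigcupT_measurable => j; rewrite /V; case: unpickle => // m.
    by case: asboolP.
  apply/seteqP; split => w.
    move=> /= Bw; exists (pickle (grid k (X w))) => //; rewrite /V pickleK.
    case: asboolP => // _ i; rewrite /= in_itv/=.
    by rewrite ler_pdivrMr// ltr_pdivlMr// mulrC grid_bounds.
  move=> [j _]; rewrite /V; case: unpickle => // m; case: asboolP => // Bm Em.
  rewrite /= /h (_ : grid k (X w) = m)//; apply/rowP => i; rewrite mxE.
  apply: floor_def; have := Em i; rewrite /= in_itv/=.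
  by rewrite ler_pdivrMr// ltr_pdivlMr// mulrC intrD1.
by apply: continuous_cvg; [exact: cg|exact: grid_cvg].
Qed.

End measurable_vector.

(** * Expectations *)

(* Only arbitrarily small steps are controlled sharply, at each time; the rough
   bound with [C] carries the inequality to the supremum of the good times. *)
Lemma lower_dini_bound (R : realType) (f : R -> R) (C c t : R) :
  (forall s h, 0 <= s -> 0 < h -> h <= 1 -> f s - C * h <= f (s + h)) ->
  (forall s e, 0 <= s -> 0 < e -> exists h, 0 < h <= e /\ f s - c * h <= f (s + h)) ->
  0 <= t -> f 0 - c * t <= f t.
Proof.
move=> flip fstep t0.
pose A := [set s | 0 <= s <= t /\ f 0 - c * s <= f s].
have A0 : A 0 by split; [rewrite lexx|lra].
have supA : has_sup A by split; [exists 0|exists t => s [/andP[]]].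
pose tau := sup A.
have tau0 : 0 <= tau by exact: (ub_le_sup supA.2).
have taut : tau <= t by apply: ge_sup; [exists 0|move=> s [/andP[]]].
have Atau : f 0 - c * tau <= f tau.
  apply/ler_addgt0Pr => e e0.
  (* Moving from a good time [s] within [del] of [tau] to [tau] itself costs at most
     [(|C| + |c|) del <= e]; the minimum with 1 respects the range of the rough bound. *)
  pose del := Num.min 1 (e / (`|C| + `|c| + 1)).
  have K0 : 0 < `|C| + `|c| + 1 by have := normr_ge0 C; have := normr_ge0 c; lra.
  have del0 : 0 < del by rewrite lt_min ltr01 divr_gt0.
  have del1 : del <= 1 by rewrite ge_min lexx.
  have delK : del * (`|C| + `|c| + 1) <= e.
    by rewrite -ler_pdivlMr// ge_min lexx orbT.
  have [s [/andP[s0 st] fs]] := sup_adherent del0 supA; rewrite -/tau => taus.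
  have stau : s <= tau by apply: (ub_le_sup supA.2); split => //; rewrite s0.
  have [seq|sne] := eqVneq s tau; first by rewrite -seq; lra.
  have slt : s < tau by rewrite lt_neqAle sne.
  have := @flip s (tau - s) s0; rewrite subr_gt0 (addrC s) subrK => /(_ slt).
  have -> : tau - s <= 1 by lra.
  move=> /(_ isT) H.
  have h1 : `|C| * (tau - s) <= `|C| * del by rewrite ler_wpM2l//; lra.
  have h2 : `|c| * (tau - s) <= `|c| * del by rewrite ler_wpM2l//; lra.
  have h3 : C * (tau - s) <= `|C| * (tau - s) by rewrite ler_wpM2r ?ler_norm//; lra.
  have h4 : - c * (tau - s) <= `|c| * (tau - s).
    by rewrite ler_wpM2r ?subr_ge0// -normrN ler_norm.
  nra.
have [tt|tt] := eqVneq tau t; first by rewrite -tt.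
have tlt : 0 < t - tau by rewrite subr_gt0 lt_neqAle tt.
have [h [/andP[h0 ht] fh]] := fstep tau (t - tau) tau0 tlt.
have : tau + h <= tau by apply: (ub_le_sup supA.2); split; [apply/andP; split|]; lra.
lra.
Qed.

Section expectation.
Context d (T : measurableType d) (R : realType) (Pr : probability T R).
Implicit Types f g : T -> R.

Definition has_mean f := Pr.-integrable setT (EFin \o f).
Definition mean f := \int[Pr]_w f w.

Lemma has_mean_measurable f : has_mean f -> measurable_fun setT f.
Proof. by move=> /measurable_int /measurable_EFinP. Qed.

Lemma has_mean_cst c : has_mean (fun=> c).
Proof. exact: finite_measure_integrable_cst. Qed.

Lemma mean_cst c : mean (fun=> c) = c.
Proof. by rewrite /mean Rintegral_cst// [X in fine X]probability_setT mulr1. Qed.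

Lemma has_meanD f g : has_mean f -> has_mean g -> has_mean (fun w => f w + g w).
Proof. by move=> hf hg; exact: (integrableD measurableT hf hg). Qed.

Lemma meanD f g : has_mean f -> has_mean g -> mean (fun w => f w + g w) = mean f + mean g.
Proof. exact: RintegralD. Qed.

Lemma has_meanB f g : has_mean f -> has_mean g -> has_mean (fun w => f w - g w).
Proof. by move=> hf hg; exact: (integrableB measurableT hf hg). Qed.

Lemma meanB f g : has_mean f -> has_mean g -> mean (fun w => f w - g w) = mean f - mean g.
Proof. exact: RintegralB. Qed.

Lemma has_meanZ c f : has_mean f -> has_mean (fun w => c * f w).
Proof. by move=> hf; exact: (integrableZl measurableT c hf). Qed.

Lemma meanZ c f : has_mean f -> mean (fun w => c * f w) = c * mean f.
Proof. by move=> hf; exact: RintegralZl. Qed.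

Lemma has_mean_sum n (f : 'I_n -> T -> R) : (forall i, has_mean (f i)) ->
  has_mean (fun w => \sum_i f i w).
Proof.
move=> hf; elim: n f hf => [|n IH] f hf.
  by under eq_fun do rewrite big_ord0; exact: has_mean_cst.
by under eq_fun do rewrite big_ord_recl; apply: has_meanD => //; exact: IH.
Qed.

Lemma mean_sum n (f : 'I_n -> T -> R) : (forall i, has_mean (f i)) ->
  mean (fun w => \sum_i f i w) = \sum_i mean (f i).
Proof.
move=> hf; elim: n f hf => [|n IH] f hf.
  by rewrite big_ord0; under eq_fun do rewrite big_ord0; exact: mean_cst.
rewrite big_ord_recl -IH//; under eq_fun do rewrite big_ord_recl.
by rewrite meanD//; exact: has_mean_sum.
Qed.

Lemma has_mean_ae_le f g : measurable_fun setT f -> has_mean g ->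
  {ae Pr, forall w, `|f w| <= g w} -> has_mean f.
Proof.
move=> mf hg fg; have mg := has_mean_measurable hg.
apply/integrableP; split; first exact/measurable_EFinP.
have /integrableP[_] := hg; apply: le_lt_trans.
apply: ae_ge0_le_integral => //.
- by apply: measurableT_comp => //; exact/measurable_EFinP.
- by apply: measurableT_comp => //; exact/measurable_EFinP.
by apply: filterS fg => w fgw _ /=; rewrite lee_fin (le_trans fgw)// ler_norm.
Qed.

Lemma has_mean_le f g : measurable_fun setT f -> has_mean g ->
  (forall w, `|f w| <= g w) -> has_mean f.
Proof. by move=> mf hg fg; apply: (has_mean_ae_le mf hg); exact: aeW. Qed.

Lemma mean_ge0_ae f : has_mean f -> {ae Pr, forall w, 0 <= f w} -> 0 <= mean f.
Proof.
move=> hf f0; have mf := has_mean_measurable hf.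
rewrite /mean /Rintegral (@ae_eq_integral _ _ _ Pr setT (fun w => `|f w|%:E))//.
- by apply: fine_ge0; apply: integral_ge0.
- exact/measurable_EFinP.
- by apply/measurable_EFinP; exact: measurableT_comp.
by apply: filterS f0 => w fw _; rewrite ger0_norm.
Qed.

Lemma mean_le_ae f g : has_mean f -> has_mean g ->
  {ae Pr, forall w, f w <= g w} -> mean f <= mean g.
Proof.
move=> hf hg fg; rewrite -subr_ge0 -meanB//; apply: mean_ge0_ae; first exact: has_meanB.
by apply: filterS fg => w; rewrite subr_ge0.
Qed.

Lemma mean_le f g : has_mean f -> has_mean g -> (forall w, f w <= g w) -> mean f <= mean g.
Proof. by move=> hf hg fg; apply: mean_le_ae => //; exact: aeW. Qed.

Lemma mean_ae_eq f g : has_mean f -> has_mean g ->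
  {ae Pr, forall w, f w = g w} -> mean f = mean g.
Proof.
move=> hf hg fg; apply/eqP; rewrite eq_le; apply/andP; split.
  by apply: mean_le_ae => //; apply: filterS fg => w ->.
by apply: mean_le_ae => //; apply: filterS fg => w ->.
Qed.

Lemma mean_bounded_cvg (f_ : nat -> T -> R) f M :
  (forall k, measurable_fun setT (f_ k)) -> measurable_fun setT f ->
  {ae Pr, forall w, forall k, `|f_ k w| <= M} ->
  {ae Pr, forall w, f_ k w @[k --> \oo] --> f w} ->
  mean (f_ k) @[k --> \oo] --> mean f.
Proof.
move=> mf_ mf fM ff.
have [] := @dominated_convergence _ _ _ Pr setT measurableT
  (fun k => EFin \o f_ k) (EFin \o f) (cst M%:E).
- by move=> k; exact/measurable_EFinP.
- exact/measurable_EFinP.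
- apply: filterS ff => w ffw _ /=.
  by apply: cvg_EFin; [exact: nearW|exact: ffw].
- exact: has_mean_cst.
- by apply: filterS fM => w fMw k _; rewrite /= lee_fin.
move=> hf _ H; rewrite /mean /Rintegral.
apply: fine_cvg; rewrite fineK; first exact: H.
exact: integrable_fin_num.
Qed.

End expectation.

(** * The one-step estimate *)

Section one_step.
Variables (R : realType) (n : nat).
Implicit Types (x v D Z : 'rV[R]_n).

(** Young's inequality with weight [r]. A product of drift, of size [h], and noise, of size
    [sqrt h], is traded for a small multiple of the squared noise and a term in [h^2]. *)
Lemma scaled_mul_le (B h r S a z : R) : 0 < r -> 0 <= B -> `|a| <= B * h -> 0 <= h ->
  z ^+ 2 <= S -> `|a * z| <= B * (r * S + r^-1 * h ^+ 2).
Proof.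
move=> r0 B0 aB h0 zS; rewrite normrM.
have z2 : `|z| ^+ 2 <= S by rewrite real_normK ?num_real.
apply: (le_trans (ler_wpM2r (normr_ge0 z) aB)); rewrite -mulrA ler_wpM2l//.
have rV : r * r^-1 = 1 by rewrite mulfV ?gt_eqF.
have ri0 : 0 < r^-1 by rewrite invr_gt0.
have z0 := normr_ge0 z.
move: (`|z|) z0 z2 => y y0 y2.
have : r * y ^+ 2 <= r * S by rewrite ler_wpM2l// ltW.
have : 0 <= r * (y - r^-1 * h) ^+ 2 + r * y ^+ 2 + r^-1 * h ^+ 2.
  by rewrite !addr_ge0// mulr_ge0 ?sqr_ge0// ltW.
have -> : r * (y - r^-1 * h) ^+ 2 = r * y ^+ 2 - 2 * (r * r^-1) * (h * y) + (r * r^-1) * (r^-1 * h ^+ 2).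
  by ring.
rewrite rV; lra.
Qed.

Lemma dotp_sqr_le D Z (B h s : R) : 0 <= B -> 0 <= h -> (forall i, `|D 0 i| <= B * h) ->
  dotp (D + s *: Z) (D + s *: Z) <= 2 * n%:R * B ^+ 2 * h ^+ 2 + 2 * s ^+ 2 * dotp Z Z.
Proof.
move=> B0 h0 DB.
have -> : 2 * s ^+ 2 * dotp Z Z = \sum_(i < n) 2 * s ^+ 2 * (Z 0 i * Z 0 i).
  by rewrite /dotp big_distrr.
have -> : 2 * n%:R * B ^+ 2 * h ^+ 2 = \sum_(i < n) 2 * (B * h) ^+ 2.
  by rewrite sumr_const card_ord -mulr_natr exprMn; ring.
rewrite -big_split /dotp /=; apply: ler_sum => i _; rewrite !mxE.
have : `|D 0 i| ^+ 2 <= (B * h) ^+ 2 by rewrite ler_sqr// nnegrE ?normr_ge0// mulr_ge0.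
rewrite real_normK ?num_real//; move: (D 0 i) (Z 0 i) => a z ha.
have := sqr_ge0 (a - s * z).
have -> : (a - s * z) ^+ 2 = 2 * a ^+ 2 + 2 * s ^+ 2 * (z * z) - (a + s * z) * (a + s * z).
  by ring.
lra.
Qed.

Lemma hessian_form_step f (B M s r : R) x D Z (h : R) :
  0 <= B -> 0 < s -> 0 < r -> 0 <= h -> (forall i, `|D 0 i| <= B * h) ->
  (forall i j, `|partial (partial f i) j x| <= M) ->
  `|hessian_form f x (D + s *: Z) - s ^+ 2 * hessian_form f x Z| <=
  (n * n)%:R * (M * (B ^+ 2 * h ^+ 2 + 2 * s * (B * (r * dotp Z Z + r^-1 * h ^+ 2)))).
Proof.
move=> B0 s0 r0 h0 DB fM.
have Z2 i : Z 0 i ^+ 2 <= dotp Z Z.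
  by rewrite expr2 (le_trans (ler_norm _))// mul_coord_le.
pose Q := M * (B ^+ 2 * h ^+ 2 + 2 * s * (B * (r * dotp Z Z + r^-1 * h ^+ 2))).
rewrite -/Q /hessian_form big_distrr/= -sumrB.
apply: (@le_trans _ _ (\sum_(i < n) \sum_(j < n) Q)); last first.
  by rewrite !sumr_const !card_ord -mulrnA mulr_natl.
apply: (le_trans (ler_norm_sum _ _ _)); apply: ler_sum => i _.
rewrite big_distrr/= -sumrB.
apply: (le_trans (ler_norm_sum _ _ _)); apply: ler_sum => j _.
have Hij := scaled_mul_le r0 B0 (DB i) h0 (Z2 j).
have Hji := scaled_mul_le r0 B0 (DB j) h0 (Z2 i).
have Hd : `|D 0 i * D 0 j| <= B ^+ 2 * h ^+ 2.
  by rewrite normrM -exprMn expr2 ler_pM.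
have M0 := fM i j; rewrite !mxE.
move: (partial _ _ _) (D 0 i) (D 0 j) (Z 0 i) (Z 0 j) Hij Hji Hd M0 => p di dj zi zj Hij Hji Hd M0.
have -> : (di + s * zi) * (dj + s * zj) * p - s ^+ 2 * (zi * zj * p) =
   p * (di * dj + s * (di * zj + dj * zi)) by ring.
rewrite normrM ler_pM// (le_trans (ler_normD _ _))// lerD// normrM gtr0_norm//.
rewrite (mulrC 2) -mulrA ler_wpM2l ?(ltW s0)// (le_trans (ler_normD _ _))//; lra.
Qed.

(** The errors are sorted by the size of their means under Brownian noise: [dotp Z Z] is of order
    [h] and has the arbitrarily small coefficient [e], while [h^2 + (dotp Z Z)^2] is of order [h^2],
    so its coefficient [C] may be large. [C] depends on [e] but not on [x], [D], [Z] or [h]. *)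
Lemma one_step_lower f (B s e : R) : Ck 2 f -> Defs.periodic f ->
  0 <= B -> 0 < s -> 0 < e -> exists C, 0 <= C /\
  forall x D Z h, 0 <= h <= 1 -> (forall i, `|D 0 i| <= B * h) ->
  f x + dotp (grad f x) D + s * dotp (grad f x) Z + s ^+ 2 / 2 * hessian_form f x Z
    - e * dotp Z Z - C * (h ^+ 2 + dotp Z Z ^+ 2) <= f (x + (D + s *: Z)).
Proof.
move=> C2 fper B0 s0 e0.
have /choice[Mij MP] (ij : 'I_n * 'I_n) :=
  periodic_bounded (@partial2_periodic _ _ f ij.1 ij.2 fper)
    (@partial2_continuous _ _ f ij.1 ij.2 C2).
pose M := \sum_ij Mij ij.
have M0 : 0 <= M by apply: sumr_ge0 => ij _; exact: (MP ij).1.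
have fM x i j : `|partial (partial f i) j x| <= M.
  rewrite (le_trans ((MP (i, j)).2 x))// /M (bigD1 (i, j))//= lerDl.
  by apply: sumr_ge0 => ij _; exact: (MP ij).1.
(* As [|D + s Z|^2] is at most [a h^2 + 2 s^2 |Z|^2], the Taylor modulus uses up [e / 2] of the
   coefficient of [|Z|^2]. *)
pose e1 := e / 4 / s ^+ 2.
have e10 : 0 < e1 by rewrite !divr_gt0// exprn_gt0.
have [K [K0 KP]] := taylor2_bound C2 fper e10.
pose N : R := (n * n)%:R.
pose W := N * M * s * B.
have W0 : 0 <= W by rewrite !mulr_ge0// ltW.
(* The cross terms of the Hessian contribute [W r |Z|^2], the other half of [e]; [W] may vanish,
   hence the [+ 1]. *)
pose r := e / (2 * (W + 1)).
have r0 : 0 < r by rewrite divr_gt0//; lra.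
have Wr : W * r <= e / 2.
  have -> : e / 2 = (W + 1) * r by rewrite /r; field; lra.
  by rewrite ler_wpM2r ?(ltW r0)//; lra.
pose a := 2 * n%:R * B ^+ 2.
have a0 : 0 <= a by apply: mulr_ge0 (sqr_ge0 _); exact: mulr_ge0.
pose C1 := N * M * B ^+ 2 / 2 + W * r^-1 + e1 * a.
pose C := C1 + 2 * K * (a ^+ 2) + 2 * K * (2 * s ^+ 2) ^+ 2.
have NMB : 0 <= N * M * B ^+ 2 by apply: mulr_ge0 (sqr_ge0 _); exact: mulr_ge0.
have ri : 0 < r^-1 by rewrite invr_gt0.
have C10 : 0 <= C1.
  apply: addr_ge0; last exact: mulr_ge0 (ltW e10) a0.
  by apply: addr_ge0; [exact: divr_ge0|exact: mulr_ge0 W0 (ltW ri)].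
have Ka : 0 <= 2 * K * a ^+ 2 by apply: mulr_ge0 (sqr_ge0 _); exact: mulr_ge0.
have Kb : 0 <= 2 * K * (2 * s ^+ 2) ^+ 2 by apply: mulr_ge0 (sqr_ge0 _); exact: mulr_ge0.
exists C; split; first by apply: addr_ge0 => //; exact: addr_ge0.
move=> x D Z h /andP[h0 h1] DB.
have V := dotp_sqr_le Z s B0 h0 DB; rewrite -/a in V.
have H := hessian_form_step Z B0 s0 r0 h0 DB (fM x).
have Tay := KP x (D + s *: Z).
rewrite dotpDr dotpZr in Tay.
have VV := dotp_ge0 (D + s *: Z); have S0 := dotp_ge0 Z.
have h4 : h ^+ 4 <= h ^+ 2 by rewrite ler_wiXn2l.
have e1s : e1 * (2 * s ^+ 2) = e / 2 by rewrite /e1; field; rewrite gt_eqF.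
rewrite ler_norml in Tay; move: Tay => /andP[Tay _].
rewrite ler_norml in H; move: H => /andP[H _].
move: (dotp (D + s *: Z) _) (dotp Z Z) V H Tay VV S0 => V S V_le H Tay VV S0.
move: (f _) (f x) (hessian_form _ _ _) (hessian_form _ _ _) (dotp _ D) (dotp _ Z) H Tay.
move=> fv fx h2' h1' gD gZ H Tay.
have V2 : V ^+ 2 <= 2 * a ^+ 2 * h ^+ 2 + 2 * (2 * s ^+ 2) ^+ 2 * S ^+ 2.
  have p0 : 0 <= a * h ^+ 2 by exact: mulr_ge0 a0 (sqr_ge0 _).
  have q0 : 0 <= 2 * s ^+ 2 * S.
    by apply: mulr_ge0 => //; apply: mulr_ge0 => //; exact: sqr_ge0.
  have : V ^+ 2 <= (a * h ^+ 2 + 2 * s ^+ 2 * S) ^+ 2.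
    by rewrite ler_sqr// nnegrE addr_ge0.
  move=> /le_trans; apply.
  have : a ^+ 2 * h ^+ 4 <= a ^+ 2 * h ^+ 2 by rewrite ler_wpM2l ?sqr_ge0.
  have := sqr_ge0 (a * h ^+ 2 - 2 * s ^+ 2 * S).
  move: (s ^+ 2) => s2; lra.
have KV : K * V ^+ 2 <= K * (2 * a ^+ 2 * h ^+ 2 + 2 * (2 * s ^+ 2) ^+ 2 * S ^+ 2).
  by rewrite ler_wpM2l.
have e1V : e1 * V <= e1 * a * h ^+ 2 + e / 2 * S.
  by have := ler_wpM2l (ltW e10) V_le; rewrite -e1s; lra.
have WrS : W * r * S <= e / 2 * S by rewrite ler_wpM2r.
have CS : (C1 + 2 * K * a ^+ 2) * h ^+ 2 + 2 * K * (2 * s ^+ 2) ^+ 2 * S ^+ 2 <=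
    C * (h ^+ 2 + S ^+ 2).
  have c1 : 0 <= C1 + 2 * K * a ^+ 2 by exact: addr_ge0.
  have -> : C = (C1 + 2 * K * a ^+ 2) + 2 * K * (2 * s ^+ 2) ^+ 2 by [].
  have := mulr_ge0 c1 (sqr_ge0 S); have := mulr_ge0 Kb (sqr_ge0 h).
  move: (C1 + _) (2 * K * (2 * _) ^+ 2) => p q; lra.
move: WrS CS H; rewrite /C1 /W -/N; move: r^-1 (C) => ri' C' WrS CS H.
have H' : 2^-1 * h1' >= s ^+ 2 / 2 * h2' - N * M * B ^+ 2 / 2 * h ^+ 2 -
  N * M * s * B * r * S - N * M * s * B * ri' * h ^+ 2 by move: H; lra.
move: Tay; rewrite mulrDl -(mulrA K) -expr2 => Tay; lra.
Qed.

End one_step.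

(** Serves twice: with [c = 0] it bounds the displacement due to the drift, and with [c] the present
    value of the drift it gives the derivative of that displacement. *)
Lemma Rintegral_increment_near (R : realType) (y : R -> R) (s h c e : R) :
  0 <= s -> 0 < h -> lebesgue_measure.-integrable `[0, s + h] (EFin \o y) ->
  (forall r, s < r <= s + h -> `|y r - c| <= e) ->
  `|\int[lebesgue_measure]_(r in `[0, s + h]) y r
    - \int[lebesgue_measure]_(r in `[0, s]) y r - c * h| <= e * h.
Proof.
move=> s0 h0 iy yc; rewrite Rintegral_itvB ?bnd_simp//; last by lra.
set J := [set` Interval (BRight s) (BRight (s + h))].
have mJ : measurable (J : set (measurableTypeR R)) by exact: measurable_itv.
have muJ : lebesgue_measure J = h%:E.
  by rewrite /J lebesgue_measure_itv/= lte_fin ltrDl h0 -EFinD addrAC subrr add0r.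
have icst k : lebesgue_measure.-integrable J (EFin \o cst k).
  apply/integrableP; split; first by apply/measurable_EFinP; exact: measurable_cst.
  by rewrite /= integral_cst//= [X in (_ * X)%E]muJ -EFinM ltry.
have iyJ : lebesgue_measure.-integrable J (EFin \o y).
  apply: integrableS iy => //.
  by apply: subset_itvr; rewrite bnd_simp.
have cE k : \int[lebesgue_measure]_(r in J) k = k * h by rewrite Rintegral_cst// [X in fine X]muJ.
have <- := cE c; rewrite -RintegralB//; last exact: icst.
have iB : lebesgue_measure.-integrable J (EFin \o (fun r => y r - c)).
  exact: (integrableB mJ iyJ (icst c)).
apply: (le_trans (le_normr_Rintegral mJ iB)); rewrite -cE.
apply: le_Rintegral => //; [exact: (integrable_norm iB)|exact: icst].
Qed.

(** * Brownian increments *)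

Section noise.
Context (R : realType) (n : nat) d (T : measurableType d) (Pr : probability T R).
Context (F : R -> set (set T)) (w X : R -> T -> 'rV[R]_n).
Hypotheses (hF : filtration F) (hw : brownian_motion Pr F w) (hX : adapted F X).

Lemma adapted_measurable (Y : R -> T -> 'rV[R]_n) t i : adapted F Y -> 0 <= t ->
  measurable_fun setT (fun omega => Y t omega 0 i).
Proof.
move=> aY t0 _ A mA; rewrite setTI.
by apply: (hF.1 t t0).2; exact: aY.
Qed.

(** [T] equipped with [F t] is itself a measurable space, on which the coordinates of [X t] are
    measurable by adaptedness. *)
Lemma adapted_comp t (g : 'rV[R]_n -> R) (A : set R) : 0 <= t -> continuous g ->
  measurable A -> F t ((g \o X t) @^-1` A).
Proof.
move=> t0 cg mA; have sF := (hF.1 t t0).1.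
pose S := g_sigma_algebraType (F t).
have mS (E : set T) : measurable (E : set S) = F t E.
  by rewrite -[in RHS](sigma_algebra_id sF).
have := @measurable_continuous_comp R n _ S (X t : S -> 'rV[R]_n) g _ cg measurableT A mA.
rewrite setTI mS; apply => i _ C mC.
by rewrite setTI mS; exact: hX.
Qed.

Definition noise s h omega : 'rV[R]_n := w (s + h) omega - w s omega.

Lemma noise_measurable s h i : 0 <= s -> 0 <= h ->
  measurable_fun setT (fun omega => noise s h omega 0 i).
Proof.
move=> s0 h0; have [aw _ _ _] := hw.
under eq_fun do rewrite !mxE.
by apply: measurable_funB; apply: adapted_measurable => //; exact: addr_ge0.
Qed.

Variables (s h : R).
Hypotheses (s0 : 0 <= s) (h0 : 0 < h).
Let Z i omega := noise s h omega 0 i.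
Let law : probability (measurableTypeR R) R := normal_prob 0 (Num.sqrt h).

Let mZ i : measurable_fun setT (Z i).
Proof. by apply: noise_measurable => //; exact: ltW. Qed.

Lemma noise_box (g : 'rV[R]_n -> R) (A : set R) (B : 'I_n -> set R) :
  continuous g -> measurable A -> (forall i, measurable (B i)) ->
  Pr ((g \o X s) @^-1` A `&` [set omega | forall i, B i (Z i omega)]) =
  (Pr ((g \o X s) @^-1` A) * \prod_(i < n) law (B i))%E.
Proof.
move=> cg mA mB; have [_ _ _ H] := hw.
have ssh : s < s + h by rewrite ltrDl.
have := H s (s + h) s0 ssh _ _ (adapted_comp s0 cg mA) mB.
by rewrite (addrC s) addrK addrC.
Qed.

Lemma noise_indep1 (g : 'rV[R]_n -> R) i : continuous g ->
  indep_law Pr (g \o X s) (Z i) law.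
Proof.
move=> cg A B mA mB.
have := @noise_box g A (fun k => if k == i then B else setT) cg mA.
rewrite (bigD1 i)//= eqxx big1 ?mule1; last first.
  by move=> k ki; rewrite (negbTE ki) -/law probability_setT.
move=> <-; last by move=> k; case: ifP.
congr (Pr (_ `&` _)); apply/seteqP; split => omega /=.
  by move=> BZ k; case: eqP => // ->.
by move=> /(_ i); rewrite eqxx.
Qed.

(** Boxes that constrain only the coordinates [i] and [j] of the noise factor into three terms; the
    product of the first two variables is then independent of the third. *)
Lemma noise_indep2 (g : 'rV[R]_n -> R) i j : continuous g -> i != j ->
  indep_law Pr (fun omega => g (X s omega) * Z i omega) (Z j) law.
Proof.
move=> cg ij; apply: (@indep_law_mul _ _ _ _ _ _ _ law) => //.
  apply: (@measurable_continuous_comp _ _ _ _ _ g) => // k; exact: adapted_measurable.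
move=> A B C mA mB mC.
have := @noise_box g A (fun k => if k == i then B else if k == j then C else setT) cg mA.
have ji : j != i by rewrite eq_sym.
rewrite (bigD1 i)//= eqxx (bigD1 j ji)/= (negbTE ji) eqxx big1 ?mule1; last first.
  by move=> k /andP[ki kj]; rewrite (negbTE ki) (negbTE kj) -/law probability_setT.
move=> <-; last by move=> k; case: ifP => //; case: ifP.
congr (Pr _); rewrite -setIA; congr (_ `&` _); apply/seteqP; split => omega /=.
  by move=> [BZ CZ] k; case: eqP => [->//|_]; case: eqP => [->//|_].
move=> H; split; first by have := H i; rewrite eqxx.
by have := H j; rewrite (negbTE ji) eqxx.
Qed.

Let sq0 : 0 < Num.sqrt h. Proof. by rewrite sqrtr_gt0. Qed.
Let sq2 : Num.sqrt h ^+ 2 = h. Proof. by rewrite sqr_sqrtr// ltW. Qed.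

Section weight.
Variables (g : 'rV[R]_n -> R) (M : R).
Hypotheses (cg : continuous g) (gM : forall x, `|g x| <= M).
Let G omega := g (X s omega).

Lemma weight_measurable : measurable_fun setT G.
Proof.
apply: (@measurable_continuous_comp _ _ _ _ _ g) => // k; exact: adapted_measurable.
Qed.

Lemma weight_has_mean : has_mean Pr G.
Proof.
apply: (has_mean_le weight_measurable (has_mean_cst Pr M)) => omega; exact: gM.
Qed.

Lemma weight_noise1 i : has_mean Pr (fun omega => G omega * Z i omega) /\
  mean Pr (fun omega => G omega * Z i omega) = 0.
Proof.
have [] := indep_expectation weight_measurable (mZ i) (@measurable_id _ _ _)
  (@noise_indep1 g i cg) weight_has_mean (normal_integrable1 sq0).
by move=> ? H; split => //; rewrite /mean H normal_moment1// mulr0.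
Qed.

(** On the diagonal the second moment of one coordinate appears. Off the diagonal [G Z_i] is
    independent of the centred [Z_j], so the mean vanishes. *)
Lemma weight_noise2 i j : has_mean Pr (fun omega => G omega * Z i omega * Z j omega) /\
  mean Pr (fun omega => G omega * Z i omega * Z j omega) =
    if i == j then h * mean Pr G else 0.
Proof.
case: eqVneq => [->|ij].
  have mf : measurable_fun setT (fun x : R => x ^+ 2) by exact: measurable_funX.
  have [] := indep_expectation weight_measurable (mZ j) mf
    (@noise_indep1 g j cg) weight_has_mean (normal_integrable2 sq0).
  rewrite normal_moment2// sq2 mulrC => H1 H2.
  by under eq_fun do rewrite -mulrA -expr2; split.
have [iGZ _] := weight_noise1 i.
have [] := indep_expectation (has_mean_measurable iGZ) (mZ j) (@measurable_id _ _ _)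
  (@noise_indep2 g i j cg ij) iGZ (normal_integrable1 sq0).
by move=> ? H; split => //; rewrite /mean H normal_moment1// mulr0.
Qed.

Lemma weight_noise4 i : has_mean Pr (fun omega => G omega * Z i omega ^+ 4) /\
  mean Pr (fun omega => G omega * Z i omega ^+ 4) =
    mean Pr G * \int[law]_x (x ^+ 4).
Proof.
have mf : measurable_fun setT (fun x : R => x ^+ 4) by exact: measurable_funX.
exact: (indep_expectation weight_measurable (mZ i) mf
    (@noise_indep1 g i cg) weight_has_mean (normal_moment4 sq0).1).
Qed.

End weight.

Let one_continuous : continuous (fun _ : 'rV[R]_n => 1 : R).
Proof. exact: cst_continuous. Qed.

Let one_bounded (x : 'rV[R]_n) : `|1 : R| <= 1. Proof. by rewrite normr1. Qed.

Lemma noise_has_mean i : has_mean Pr (Z i).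
Proof.
have [+ _] := weight_noise1 one_continuous one_bounded i.
by under eq_fun do rewrite mul1r.
Qed.

Lemma noise_square i : has_mean Pr (fun omega => Z i omega * Z i omega) /\
  mean Pr (fun omega => Z i omega * Z i omega) = h.
Proof.
have := weight_noise2 one_continuous one_bounded i i.
rewrite eqxx mean_cst mulr1; by under eq_fun do rewrite mul1r.
Qed.

Lemma noise_fourth i : has_mean Pr (fun omega => Z i omega ^+ 4) /\
  mean Pr (fun omega => Z i omega ^+ 4) <= 57 * h ^+ 2.
Proof.
have := weight_noise4 one_continuous one_bounded i.
rewrite mean_cst mul1r; under eq_fun do rewrite mul1r; move=> [H ->]; split => //.
by rewrite (le_trans (normal_moment4 sq0).2)// -{2}sq2 -exprM.
Qed.

End noise.

(** * Displacement due to the drift *)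

Section drift.
Context (R : realType) (n : nat) d (T : measurableType d) (Pr : probability T R).
Context (F : R -> set (set T)) (w X : R -> T -> 'rV[R]_n).
Context (b : 'rV[R]_n -> 'rV[R]_n) (sigma : R) (x0 : 'rV[R]_n) (M : R).
Hypotheses (hF : filtration F) (hw : brownian_motion Pr F w).
Hypothesis hx : diffusion Pr F w b sigma x0 X.
Hypotheses (bc : forall i, continuous (fun y => b y 0 i)).
Hypothesis bM : forall y i, `|b y 0 i| <= M.

Let aX : adapted F X. Proof. by case: hx. Qed.

(** Defined by subtraction, so that measurability comes directly from that of [X] and [w]; it is the
    time integral of [b] along the path only almost surely. *)
Definition drift s h omega : 'rV[R]_n :=
  X (s + h) omega - X s omega - sigma *: noise w s h omega.

Lemma driftE s h omega :
  X (s + h) omega = X s omega + (drift s h omega + sigma *: noise w s h omega).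
Proof. by rewrite /drift subrK [RHS]addrC subrK. Qed.

Lemma drift_measurable s h i : 0 <= s -> 0 <= h ->
  measurable_fun setT (fun omega => drift s h omega 0 i).
Proof.
move=> s0 h0; rewrite /drift; under eq_fun do rewrite !mxE.
apply: measurable_funB; first apply: measurable_funB.
- by apply: (adapted_measurable hF i aX); exact: addr_ge0.
- exact: (adapted_measurable hF i aX).
apply: measurable_funM => //.
have := noise_measurable hF hw i s0 h0.
by under eq_fun do rewrite !mxE.
Qed.

Let drift_near omega s h i c e :
  (forall t : R, 0 <= t -> forall i : 'I_n,
        lebesgue_measure.-integrable `[0, t]
          (fun s => (b (X s omega) 0 i)%:E) /\
        X t omega 0 i = x0 0 i
          + \int[lebesgue_measure]_(s in `[0, t]) b (X s omega) 0 i
          + sigma * w t omega 0 i) ->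
  0 <= s -> 0 < h -> (forall r, s < r <= s + h -> `|b (X r omega) 0 i - c| <= e) ->
  `|drift s h omega 0 i - c * h| <= e * h.
Proof.
move=> H s0 h0 bce; have sh0 : 0 <= s + h by rewrite addr_ge0// ltW.
have [iy Xsh] := H _ sh0 i; have [_ Xs] := H _ s0 i.
rewrite (_ : drift s h omega 0 i = \int[lebesgue_measure]_(r in `[0, s + h]) b (X r omega) 0 i
    - \int[lebesgue_measure]_(r in `[0, s]) b (X r omega) 0 i).
  exact: Rintegral_increment_near.
by rewrite !mxE Xsh Xs; ring.
Qed.

(** The integral equation holds off one null set for all times, so the bound does as well. *)
Lemma drift_bound : {ae Pr, forall omega, forall s h i, 0 <= s -> 0 < h ->
  `|drift s h omega 0 i| <= M * h}.
Proof.
case: hx => _ _; apply: filterS => omega H s h i s0 h0.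
have := @drift_near omega s h i 0 M H s0 h0.
by rewrite mul0r subr0; apply => r _; rewrite subr0.
Qed.

(** Along a continuous path the average of [b] over a shrinking interval tends to its value at the
    left end. Steps [1/(k+1)] give a sequence, as dominated convergence requires. *)
Lemma drift_cvg s : 0 <= s -> {ae Pr, forall omega, forall i,
  k.+1%:R * drift s k.+1%:R^-1 omega 0 i @[k --> \oo] --> b (X s omega) 0 i}.
Proof.
move=> s0; case: hx => _ cX eqX; apply: filterS2 cX eqX => omega cX H i.
apply/cvgrPdist_le => /= e e0.
have [del del0 Hdel] : exists2 del, 0 < del &
    forall r, s < r <= s + del -> `|b (X r omega) 0 i - b (X s omega) 0 i| <= e.
  have sin : `[0, +oo[%classic s by rewrite /= in_itv/= s0.
  have cXs := (subspace_continuousP _ _).1 cX s sin.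
  have /cvgrPdist_le /(_ _ e0) := cvg_comp _ _ cXs (@bc i (X s omega)).
  move=> /nbhs_ballP[del /= del0 Hdel]; exists (del / 2); first exact: divr_gt0.
  move=> r /andP[sr rs]; rewrite distrC; apply: Hdel; last first.
    by rewrite /= in_itv/= (le_trans s0) ?ltW.
  by rewrite /ball/= ltr_norml; lra.
near=> k.
have k0 : 0 < k.+1%:R :> R by [].
have kd : k.+1%:R^-1 <= del.
  near: k; have := near_infty_natSinv_lt (PosNum del0).
  by apply: filterS => k /= /ltW.
have := @drift_near omega s k.+1%:R^-1 i (b (X s omega) 0 i) e H s0.
rewrite invr_gt0 => /(_ k0) => Hk.
have {}Hk : `|drift s k.+1%:R^-1 omega 0 i - b (X s omega) 0 i * k.+1%:R^-1| <= e * k.+1%:R^-1.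
  by apply: Hk => r /andP[sr rs]; apply: Hdel; rewrite sr (le_trans rs)// lerD2l.
move: Hk; rewrite -(ler_pM2r k0) divfK ?gt_eqF// -[X in _ * X]gtr0_norm// -normrM.
rewrite mulrBl divfK ?gt_eqF// distrC mulrC.
by [].
Unshelve. all: by end_near.
Qed.

End drift.

(** Cauchy-Schwarz against the constant vector; it reduces the mean of [|Z|^4] to fourth moments of
    single coordinates. *)
Lemma dotp_square_le (R : realType) (n : nat) (v : 'rV[R]_n) :
  dotp v v ^+ 2 <= n%:R * \sum_i v 0 i ^+ 4.
Proof.
pose S := \sum_i v 0 i ^+ 4.
have E : n%:R * S = \sum_(i < n) \sum_(j < n) 2^-1 * (v 0 i ^+ 4 + v 0 j ^+ 4).
  transitivity (\sum_(i < n) 2^-1 * (n%:R * v 0 i ^+ 4 + S)).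
    rewrite -big_distrr/= big_split/= -big_distrr/= sumr_const card_ord.
    by rewrite -/S -[S *+ n]mulr_natl; move: (n%:R * S) => a; field.
  apply: eq_bigr => i _; rewrite -big_distrr/= big_split/= sumr_const card_ord.
  by rewrite -[(_ ^+ 4) *+ n]mulr_natl.
rewrite E expr2 /dotp big_distrl/=; apply: ler_sum => i _.
rewrite big_distrr/=; apply: ler_sum => j _.
have := sqr_ge0 (v 0 i ^+ 2 - v 0 j ^+ 2); move: (v 0 i) (v 0 j) => x y H.
have -> : x * x * (y * y) = x ^+ 2 * y ^+ 2 by ring.
have -> : 2^-1 * (x ^+ 4 + y ^+ 4) = 2^-1 * (x ^+ 2 - y ^+ 2) ^+ 2 + x ^+ 2 * y ^+ 2 by field.
by rewrite lerDr mulr_ge0.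
Qed.

(** * Growth of the mean along the diffusion *)

Section supersolution.
Context (R : realType) (n : nat) d (T : measurableType d) (Pr : probability T R).
Context (F : R -> set (set T)) (w X : R -> T -> 'rV[R]_n).
Context (b : 'rV[R]_n -> 'rV[R]_n) (sigma : R) (x0 : 'rV[R]_n) (M : R).
Hypotheses (hF : filtration F) (hw : brownian_motion Pr F w).
Hypothesis hx : diffusion Pr F w b sigma x0 X.
Hypothesis sigma_gt0 : 0 < sigma.
Hypotheses (bc : forall i, continuous (fun y => b y 0 i)).
Hypotheses (M0 : 0 <= M) (bM : forall y i, `|b y 0 i| <= M).

Let aX : adapted F X. Proof. by case: hx. Qed.
Notation drift := (drift w X sigma).

Lemma initial_value : {ae Pr, forall omega, X 0 omega = x0}.
Proof.
have [_ w0 _ _] := hw; case: hx => _ _; apply: filterS2 w0 => omega w0 H.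
apply/rowP => i; have [_ ->] := H 0 (lexx _) i.
by rewrite w0 mxE mulr0 addr0 set_itv1 Rintegral_set1 addr0.
Qed.

(** The position is dominated by [|x0|], the drift bound [M t] and an integrable increment of noise.
    Increments are treated over positive durations, so [t = 0] is settled by the initial value. *)
Lemma position_has_mean t i : 0 <= t -> has_mean Pr (fun omega => X t omega 0 i).
Proof.
rewrite le_eqVlt => /predU1P[<-|t0].
  apply: (has_mean_ae_le _ (has_mean_cst Pr `|x0 0 i|)).
    exact: (adapted_measurable hF i aX).
  by apply: filterS initial_value => omega ->.
have hZ := noise_has_mean hF hw aX (lexx 0) t0 i.
have hnZ : has_mean Pr (fun omega => `|noise w 0 t omega 0 i|).
  exact: (integrable_norm hZ).
apply: (has_mean_ae_le _ (has_meanD (has_mean_cst Pr (`|x0 0 i| + M * t))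
  (has_meanZ sigma hnZ))).
  by apply: (adapted_measurable hF i aX); exact: ltW.
apply: filterS2 initial_value (drift_bound hx bM) => omega X0 /(_ 0 t i (lexx 0) t0) D.
have -> : X t omega = X (0 + t) omega by rewrite add0r.
rewrite (driftE w X sigma) X0.
move: (drift 0 t omega) (noise w 0 t omega) D => D Z DM; rewrite !mxE addrA.
rewrite (le_trans (ler_normD _ _))// lerD ?normrM ?(gtr0_norm sigma_gt0)//.
by rewrite (le_trans (ler_normD _ _))// lerD2l.
Qed.

Variables (f : 'rV[R]_n -> R) (q : 'rV[R]_n).
Hypotheses (fC2 : Ck 2 f) (fper : Defs.periodic f).

Let psi t omega := f (X t omega) + dotp q (X t omega).
Let value t := mean Pr (psi t).

Let slope x i := grad f x 0 i + q 0 i.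
Let hess x i j := partial (partial f i) j x.

Let gradE x i : grad f x 0 i = partial f i x.
Proof. by rewrite mxE. Qed.

Lemma coefficients_bounded : exists K, [/\ 0 <= K, forall x, `|f x| <= K,
  forall x i, `|slope x i| <= K & forall x i j, `|hess x i j| <= K].
Proof.
have fc : continuous f by move=> x; apply: differentiable_continuous; exact: (proj1 fC2).
have [K1 [K10 H1]] := periodic_bounded fper fc.
have /choice[K2 H2] i := periodic_bounded (@periodic_derive _ _ f (delta_mx 0 i) fper)
  (@partial_continuous _ _ f i fC2).
have /choice[K3 H3] (ij : 'I_n * 'I_n) :=
  periodic_bounded (@partial2_periodic _ _ f ij.1 ij.2 fper)
    (@partial2_continuous _ _ f ij.1 ij.2 fC2).
pose S2 := \sum_i (K2 i + `|q 0 i|); pose S3 := \sum_ij K3 ij.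
have S20 : 0 <= S2 by apply: sumr_ge0 => i _; rewrite addr_ge0//; exact: (H2 i).1.
have S30 : 0 <= S3 by apply: sumr_ge0 => ij _; exact: (H3 ij).1.
exists (K1 + S2 + S3); split.
- by rewrite !addr_ge0.
- by move=> x; have := H1 x; lra.
- move=> x i; have : `|slope x i| <= S2.
    rewrite /slope gradE (le_trans (ler_normD _ _))// /S2 (bigD1 i)//=.
    rewrite -[leLHS]addr0 lerD// ?lerD2r; first exact: (H2 i).2.
    by apply: sumr_ge0 => k _; rewrite addr_ge0//; exact: (H2 k).1.
  lra.
- move=> x i j; have : `|hess x i j| <= S3.
    rewrite /S3 (bigD1 (i, j))//= -[leLHS]addr0 lerD//; first exact: (H3 (i, j)).2.
    by apply: sumr_ge0 => k _; exact: (H3 k).1.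
  lra.
Qed.

Let slope_continuous i : continuous (fun x => slope x i).
Proof.
apply: continuous_add; last exact: cst_continuous.
rewrite (_ : (fun x => _) = partial f i); first exact: partial_continuous.
by apply/funext => x; rewrite gradE.
Qed.

Let hess_continuous i j : continuous (fun x => hess x i j).
Proof. exact: partial2_continuous. Qed.

Lemma psi_has_mean t : 0 <= t -> has_mean Pr (psi t).
Proof.
move=> t0; have [K [K0 fK _ _]] := coefficients_bounded.
apply: has_meanD.
  have fc : continuous f by move=> x; apply: differentiable_continuous; exact: (proj1 fC2).
  exact: (weight_has_mean Pr hF aX t0 fc fK).
apply: has_mean_sum => i; apply: has_meanZ; exact: position_has_mean.
Qed.


Let laplacian_mean s := mean Pr (fun omega => laplacian f (X s omega)).

Let drift_slope s h omega := \sum_i slope (X s omega) i * drift s h omega 0 i.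

Lemma laplacian_has_mean s : 0 <= s -> has_mean Pr (fun omega => laplacian f (X s omega)).
Proof.
move=> s0; have [K [_ _ _ hK]] := coefficients_bounded.
apply: has_mean_sum => i.
exact: (weight_has_mean Pr hF aX s0 (@hess_continuous i i) (fun x => hK x i i)).
Qed.

Lemma slope_noise s h : 0 <= s -> 0 < h ->
  has_mean Pr (fun omega => \sum_i slope (X s omega) i * noise w s h omega 0 i) /\
  mean Pr (fun omega => \sum_i slope (X s omega) i * noise w s h omega 0 i) = 0.
Proof.
move=> s0 h0; have [K [_ _ sK _]] := coefficients_bounded.
have H i := weight_noise1 hF hw aX s0 h0 (@slope_continuous i) (fun x => sK x i) i.
split; first by apply: has_mean_sum => i; exact: (H i).1.
by rewrite mean_sum => [|i]; [apply: big1 => i _; exact: (H i).2|exact: (H i).1].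
Qed.

(** The source of the second-order term of Ito's formula: mixed products of the noise have mean zero
    against the Hessian at time [s], and each square contributes [h]. *)
Lemma hessian_noise s h : 0 <= s -> 0 < h ->
  has_mean Pr (fun omega => hessian_form f (X s omega) (noise w s h omega)) /\
  mean Pr (fun omega => hessian_form f (X s omega) (noise w s h omega)) =
    h * laplacian_mean s.
Proof.
move=> s0 h0; have [K [_ _ _ hK]] := coefficients_bounded.
have H i j := weight_noise2 hF hw aX s0 h0 (@hess_continuous i j) (fun x => hK x i j) i j.
have E i j : (fun omega => noise w s h omega 0 i * noise w s h omega 0 j *
    partial (partial f i) j (X s omega)) =
    (fun omega => hess (X s omega) i j * noise w s h omega 0 i * noise w s h omega 0 j).
  by apply/funext => omega; rewrite mulrC mulrA.
have H1 i : has_mean Pr (fun omega => \sum_j noise w s h omega 0 i * noise w s h omega 0 j *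
    partial (partial f i) j (X s omega)).
  by apply: has_mean_sum => j; rewrite E; exact: (H i j).1.
split; first exact: has_mean_sum.
rewrite mean_sum// /laplacian_mean mean_sum; last first.
  move=> i; exact: (weight_has_mean Pr hF aX s0 (@hess_continuous i i) (fun x => hK x i i)).
rewrite big_distrr/=; apply: eq_bigr => i _.
rewrite mean_sum; last by move=> j; rewrite E; exact: (H i j).1.
have Hm j : mean Pr (fun omega => noise w s h omega 0 i * noise w s h omega 0 j *
    partial (partial f i) j (X s omega)) =
    if i == j then h * mean Pr (fun omega => hess (X s omega) i j) else 0.
  by rewrite E; exact: (H i j).2.
rewrite (eq_bigr _ (fun j _ => Hm j)) (bigD1 i)// eqxx big1 => [|j ji]; first exact: addr0.
by rewrite eq_sym (negbTE ji).
Qed.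

Lemma noise_sum_square s h : 0 <= s -> 0 < h ->
  has_mean Pr (fun omega => dotp (noise w s h omega) (noise w s h omega)) /\
  mean Pr (fun omega => dotp (noise w s h omega) (noise w s h omega)) = n%:R * h.
Proof.
move=> s0 h0; have H i := noise_square hF hw aX s0 h0 i.
split; first by apply: has_mean_sum => i; exact: (H i).1.
rewrite mean_sum => [|i]; last exact: (H i).1.
by under eq_bigr do rewrite (H _).2; rewrite sumr_const card_ord mulr_natl.
Qed.

Lemma noise_sum_fourth s h : 0 <= s -> 0 < h ->
  has_mean Pr (fun omega => \sum_i noise w s h omega 0 i ^+ 4) /\
  mean Pr (fun omega => \sum_i noise w s h omega 0 i ^+ 4) <= n%:R * (57 * h ^+ 2).
Proof.
move=> s0 h0; have H i := noise_fourth hF hw aX s0 h0 i.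
split; first by apply: has_mean_sum => i; exact: (H i).1.
rewrite mean_sum => [|i]; last exact: (H i).1.
apply: (@le_trans _ _ (\sum_(i < n) 57 * h ^+ 2)); last by rewrite sumr_const card_ord -[leLHS]mulr_natl.
by apply: ler_sum => i _; exact: (H i).2.
Qed.

Lemma drift_slope_has_mean s h : 0 <= s -> 0 < h -> has_mean Pr (drift_slope s h).
Proof.
move=> s0 h0; have [K [K0 _ sK _]] := coefficients_bounded.
apply: (has_mean_ae_le _ (has_mean_cst Pr (\sum_(i < n) K * (M * h)))).
  apply: measurable_sum => i; apply: measurable_funM.
    exact: (weight_measurable hF aX s0 (@slope_continuous i)).
  exact: (drift_measurable hF hw hx i s0 (ltW h0)).
apply: filterS (drift_bound hx bM) => omega /(_ s h _ s0 h0) D.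
rewrite (le_trans (ler_norm_sum _ _ _))//; apply: ler_sum => i _.
by rewrite normrM ler_pM.
Qed.

(** The mean of the one-step inequality, in which the first-order noise term vanishes. [C] depends
    on [e] but is uniform in [s] and [h]; the drift term is left exact, to be estimated roughly or
    in the limit. *)
Lemma value_step e : 0 < e -> exists C, 0 <= C /\ forall s h, 0 <= s -> 0 < h <= 1 ->
  value s + mean Pr (drift_slope s h) + sigma ^+ 2 / 2 * (h * laplacian_mean s)
    - e * (n%:R * h) - C * h ^+ 2 <= value (s + h).
Proof.
move=> e0; have [C [C0 HC]] := one_step_lower fC2 fper M0 sigma_gt0 e0.
(* [|Z|^4] is at most [n] times the sum of the [Z_i^4], whose [n] means are each at most
   [57 h^2]. *)
exists (C * (1 + n%:R * (n%:R * 57))); split.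
  by rewrite mulr_ge0// addr_ge0// !mulr_ge0.
move=> s h s0 /andP[h0 h1].
have sh0 : 0 <= s + h by rewrite addr_ge0// ltW.
have m1 := psi_has_mean s0; have m2 := drift_slope_has_mean s0 h0.
have [m3 E3] := slope_noise s0 h0; have [m4 E4] := hessian_noise s0 h0.
have [m5 E5] := noise_sum_square s0 h0; have [m6 E6] := noise_sum_fourth s0 h0.
have a1 := has_meanD m1 m2.
have a2 := has_meanD a1 (has_meanZ sigma m3).
have a3 := has_meanD a2 (has_meanZ (sigma ^+ 2 / 2) m4).
have a4 := has_meanB a3 (has_meanZ e m5).
have b1 := has_meanD (has_mean_cst Pr (h ^+ 2)) (has_meanZ n%:R m6).
have a5 := has_meanB a4 (has_meanZ C b1).
have := mean_le_ae a5 (psi_has_mean sh0).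
rewrite (meanB a4 (has_meanZ C b1)) (meanZ C b1) (meanD (has_mean_cst Pr (h ^+ 2)) (has_meanZ n%:R m6)).
rewrite (meanZ n%:R m6) mean_cst.
rewrite (meanB a3 (has_meanZ e m5)) (meanZ e m5) E5.
rewrite (meanD a2 (has_meanZ (sigma ^+ 2 / 2) m4)) (meanZ _ m4) E4.
rewrite (meanD a1 (has_meanZ sigma m3)) (meanZ _ m3) E3 (meanD m1 m2) mulr0 addr0.
move=> H; apply: le_trans (H _).
  rewrite lerD2l lerN2 -mulrA ler_wpM2l// mulrDl mul1r lerD2l -mulrA ler_wpM2l//.
  by rewrite (le_trans E6)// mulrA.
apply: filterS (drift_bound hx bM) => omega /(_ s h _ s0 h0) D.
rewrite /psi (driftE w X sigma).
have h01 : 0 <= h <= 1 by rewrite (ltW h0).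
have := HC (X s omega) (drift s h omega) (noise w s h omega) h h01 D.
have := dotp_square_le (noise w s h omega).
rewrite /drift_slope /slope.
move: (drift s h omega) (noise w s h omega) => Dv Z H4; rewrite !dotpDr dotpZr.
have -> : \sum_i (grad f (X s omega) 0 i + q 0 i) * Dv 0 i =
    dotp (grad f (X s omega)) Dv + dotp q Dv.
  by rewrite -dotpDl; apply: eq_bigr => i _; rewrite !mxE.
have -> : \sum_i (grad f (X s omega) 0 i + q 0 i) * Z 0 i =
    dotp (grad f (X s omega)) Z + dotp q Z.
  by rewrite -dotpDl; apply: eq_bigr => i _; rewrite !mxE.
have : C * dotp Z Z ^+ 2 <= C * (n%:R * \sum_i Z 0 i ^+ 4) by apply: ler_wpM2l.
move: (f _) (f _) (dotp _ Dv) (dotp _ Dv) (dotp _ Z) (dotp _ Z) (dotp Z Z) (hessian_form _ _ _) (\sum_i _) => f1 f2 u1 u2 u3 u4 S Q S4 *.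
lra.
Qed.


(** Dominated convergence: the rescaled drift is bounded by [M] and the slopes by [K]. *)
Lemma drift_slope_cvg s : 0 <= s ->
  k.+1%:R * mean Pr (drift_slope s k.+1%:R^-1) @[k --> \oo] -->
  mean Pr (fun omega => \sum_i slope (X s omega) i * b (X s omega) 0 i).
Proof.
move=> s0; have [K [K0 _ sK _]] := coefficients_bounded.
have k0 (k : nat) : 0 < k.+1%:R^-1 :> R by rewrite invr_gt0.
pose g (k : nat) omega := \sum_i slope (X s omega) i * (k.+1%:R * drift s k.+1%:R^-1 omega 0 i).
have gE k : k.+1%:R * mean Pr (drift_slope s k.+1%:R^-1) = mean Pr (g k).
  rewrite -meanZ; last exact: drift_slope_has_mean.
  congr (mean Pr _); apply/funext => omega; rewrite /drift_slope big_distrr/=.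
  by apply: eq_bigr => i _; rewrite mulrCA.
under eq_fun do rewrite gE.
apply: (@mean_bounded_cvg _ _ _ _ _ _ (\sum_(i < n) K * M)).
- move=> k; apply: measurable_sum => i; apply: measurable_funM.
    exact: (weight_measurable hF aX s0 (@slope_continuous i)).
  apply: measurable_funM => //.
  exact: (drift_measurable hF hw hx i s0 (ltW (k0 k))).
- apply: measurable_sum => i; apply: measurable_funM.
    exact: (weight_measurable hF aX s0 (@slope_continuous i)).
  exact: (weight_measurable hF aX s0 (@bc i)).
- apply: filterS (drift_bound hx bM) => omega D k.
  rewrite (le_trans (ler_norm_sum _ _ _))//; apply: ler_sum => i _.
  rewrite normrM ler_pM// normrM ger0_norm// mulrC -ler_pdivlMr//.
  exact: D.
- apply: filterS (drift_cvg hx bc s0) => omega D.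
  apply: (@cvg_big _ _ +%R) => [|i _]; first exact: add_continuous.
  by apply: cvgM; [exact: cvg_cst|exact: D].
Qed.

Variable c : R.
Hypothesis generator_ge : forall y,
  - c <= dotp (grad f y + q) (b y) + sigma ^+ 2 / 2 * laplacian f y.

Let value_lipschitz : exists C, forall s h, 0 <= s -> 0 < h -> h <= 1 ->
  value s - C * h <= value (s + h).
Proof.
have [K [K0 _ sK hK]] := coefficients_bounded; have [C [C0 HC]] := value_step ltr01.
exists (\sum_(i < n) K * M + sigma ^+ 2 / 2 * \sum_(i < n) K + n%:R + C).
move=> s h s0 h0 h1; apply: le_trans (HC s h s0 _); last by rewrite h0.
have D : - (\sum_(i < n) K * M) * h <= mean Pr (drift_slope s h).
  rewrite -[leLHS](mean_cst Pr); apply: mean_le_ae; first exact: has_mean_cst.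
    exact: drift_slope_has_mean.
  apply: filterS (drift_bound hx bM) => omega /(_ s h _ s0 h0) D.
  rewrite mulNr lerNl (le_trans (ler_norm _))// normrN big_distrl/=.
  rewrite (le_trans (ler_norm_sum _ _ _))//; apply: ler_sum => i _.
  by rewrite normrM -mulrA ler_pM.
have Lp : - (\sum_(i < n) K) <= laplacian_mean s.
  rewrite -[leLHS](mean_cst Pr); apply: mean_le; first exact: has_mean_cst.
    exact: laplacian_has_mean.
  move=> omega; rewrite lerNl (le_trans (ler_norm _))// normrN.
  rewrite (le_trans (ler_norm_sum _ _ _))//; apply: ler_sum => i _; exact: hK.
have h2 : C * h ^+ 2 <= C * h by rewrite ler_wpM2l// expr2 ler_piMr// ltW.
have Lp' : - (sigma ^+ 2 / 2 * \sum_(i < n) K) * h <= sigma ^+ 2 / 2 * (h * laplacian_mean s).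
  have -> : - (sigma ^+ 2 / 2 * \sum_(i < n) K) * h =
    sigma ^+ 2 / 2 * (h * - \sum_(i < n) K) by ring.
  by rewrite ler_wpM2l ?divr_ge0 ?sqr_ge0// ler_wpM2l// ltW.
move: D h2 Lp'; move: (\sum_(i < n) K * M) (\sum_(i < n) K) (mean _ _) (laplacian_mean s) (value s) => *.
lra.
Qed.

Let value_dini e : 0 < e -> forall s r, 0 <= s -> 0 < r ->
  exists h, 0 < h <= r /\ value s - (c + e) * h <= value (s + h).
Proof.
move=> e0 s r s0 r0; have [K [K0 _ sK _]] := coefficients_bounded.
(* The loss [e] is split in three: noise error [e1 n], second-order term [C h], and distance of the
   averaged drift from its limit. *)
pose e1 := e / 3 / (n.+1%:R).
have e10 : 0 < e1 by rewrite !divr_gt0.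
have e1n : e1 * n%:R <= e / 3.
  by rewrite /e1 mulrAC ler_pdivrMr// ler_wpM2l ?ler_nat// divr_ge0// ltW.
have [C [C0 HC]] := value_step e10.
have cvgm := drift_slope_cvg s0.
set L := mean Pr _ in cvgm.
have Lc : - c <= L + sigma ^+ 2 / 2 * laplacian_mean s.
  have i1 : has_mean Pr (fun omega => \sum_i slope (X s omega) i * b (X s omega) 0 i).
    apply: has_mean_sum => i.
    apply: (@weight_has_mean _ _ _ _ Pr _ _ hF aX s s0 (fun y => slope y i * b y 0 i) (K * M)).
      exact: (continuous_mul (@slope_continuous i) (@bc i)).
    by move=> y; rewrite normrM ler_pM.
  have i2 := laplacian_has_mean s0.
  rewrite -[leLHS](mean_cst Pr) /L /laplacian_mean -(meanZ _ i2) -(meanD i1 (has_meanZ _ i2)).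
  apply: mean_le; [exact: has_mean_cst|exact: has_meanD i1 (has_meanZ _ i2)|].
  move=> omega; apply: (le_trans (generator_ge (X s omega))); rewrite lerD2r.
  rewrite le_eqVlt; apply/orP; left; apply/eqP.
  by rewrite /dotp; apply: eq_bigr => i _; rewrite /slope [in LHS]mxE.
have e3 : 0 < e / 3 by rewrite divr_gt0.
have kL : \forall k \near \oo, L - e / 3 <= k.+1%:R * mean Pr (drift_slope s k.+1%:R^-1).
  have /cvgrPdist_le /(_ _ e3) := cvgm; apply: filterS => k.
  by rewrite distrC ler_distl => /andP[].
have Ce : 0 < e / 3 / (C + 1) by rewrite divr_gt0//; lra.
have : \forall k \near \oo, exists h, 0 < h <= r /\ value s - (c + e) * h <= value (s + h).
  have small m : 0 < m -> \forall k \near \oo, k.+1%:R^-1 <= m :> R.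
    move=> m0; have := near_infty_natSinv_lt (PosNum m0).
    by apply: filterS => k /= /ltW.
  apply: filterS3 kL (small _ r0) (small _ Ce) => k.
  set h := k.+1%:R^-1; set m := mean _ _ => kL kr kC.
  have h0 : 0 < h by rewrite invr_gt0.
  have h1 : h <= 1 by rewrite invf_le1// ler1n.
  have kh : k.+1%:R * h = 1 by rewrite /h mulfV.
  exists h; split; first by rewrite h0.
  apply: le_trans (HC s h s0 _); last by rewrite h0.
  have Ch : C * h <= e / 3.
    have : h * (C + 1) <= e / 3 by rewrite -ler_pdivlMr//; lra.
    by move=> H; rewrite (le_trans _ H)// mulrC ler_wpM2l ?(ltW h0)//; lra.
  have Lh : h * (L - e / 3) <= m.
    have := ler_wpM2l (ltW h0) kL.
    by rewrite mulrA (mulrC h k.+1%:R) kh mul1r.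
  have /= Ch2 := ler_wpM2r (ltW h0) Ch.
  have /= e1h := ler_wpM2r (ltW h0) e1n.
  have /= Lch := ler_wpM2r (ltW h0) Lc.
  rewrite -/m; move: (value s) (laplacian_mean s) (m) Lh Lch => v l m' Lh Lch.
  move: (sigma ^+ 2 / 2) Lch Ch2 e1h Lh => a Lch Ch2 e1h Lh.
  move: n%:R e1h => N e1h.
lra.
by move=> /filter_ex[].
Qed.

Lemma supersolution_lower t : 0 <= t -> f x0 + dotp q x0 - c * t <= value t.
Proof.
move=> t0; have [C HC] := value_lipschitz.
have v0 : value 0 = f x0 + dotp q x0.
  rewrite -[RHS](mean_cst Pr); apply: mean_ae_eq; [exact: psi_has_mean|exact: has_mean_cst|].
  by apply: filterS initial_value => omega; rewrite /psi => ->.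
apply/ler_addgt0Pr => e e0.
(* The surplus rate acts during time [t] and so costs at most [e]; the [+ 1] covers [t = 0]. *)
have e1 : 0 < e / (t + 1) by rewrite divr_gt0//; lra.
have := lower_dini_bound HC (value_dini e1) t0; rewrite v0.
have : e / (t + 1) * t <= e.
  by rewrite mulrAC ler_pdivrMr ?ler_wpM2l//; lra.
lra.
Qed.

End supersolution.

(** * The cell problem *)

Lemma continuous_rV (R : realType) (n : nat) (T : topologicalType) (f : T -> 'rV[R]_n) :
  (forall i, continuous (fun x => f x 0 i)) -> continuous f.
Proof.
move=> fc x; apply/cvgrPdist_le => e e0.
have : \forall y \near x, forall i, `|f x 0 i - f y 0 i| <= e.
  apply: filter_forall => i; have /cvgrPdist_le := fc i x.
  by move=> /(_ _ e0).
apply: filterS => y fxy; apply: rV_norm_le => [|i]; first exact: ltW.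
by rewrite !mxE.
Qed.

(* A C^2 solution is its own test function. *)
Lemma viscosity_classical (R : realType) (n : nat) (H : 'rV[R]_n -> 'rV[R]_n -> R)
    (sigma : R) (P : 'rV[R]_n) (lam : R) (u : 'rV[R]_n -> R) (y : 'rV[R]_n) :
  viscosity_solution H sigma P lam u -> Ck 2 u ->
  sigma ^+ 2 / 2 * laplacian u y = H (P + grad u y) y - lam.
Proof.
move=> [_ sub super] C2.
have le_uu : \forall z \near y, u z - u z <= u y - u y by near=> z; rewrite !subrr.
have ge_uu : \forall z \near y, u y - u y <= u z - u z by near=> z; rewrite !subrr.
have := sub u y C2 le_uu; have := super u y C2 ge_uu; rewrite /= !mulNr => h1 h2.
apply/eqP; rewrite eq_le; apply/andP; split; move: h1 h2;
  move: (_ * laplacian _ _) (H _ _) => *; lra.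
Unshelve. all: by end_near.
Qed.

Section cell_problem.
Context (R : realType) (n : nat) (L : 'rV[R]_n -> 'rV[R]_n -> R) (hL : lagrangian L).
Variables (sigma : R) (Hbar : 'rV[R]_n -> R) (u : 'rV[R]_n -> 'rV[R]_n -> R).
Hypothesis hu : corrector (hamiltonian L) sigma Hbar u.

Definition feedback (P y : 'rV[R]_n) : 'rV[R]_n :=
  - grad (fun p => hamiltonian L p y) (P + grad (u ^~ P) y).

Lemma feedback_optimal P y : hamiltonian L (P + grad (u ^~ P) y) y =
  - dotp (P + grad (u ^~ P) y) (feedback P y) - L y (feedback P y).
Proof.
have [v [_ HE vE]] := hamiltonian_legendre hL.
by rewrite /feedback vE HE.
Qed.

Lemma feedback_continuous P i : continuous (fun y => feedback P y 0 i).
Proof.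
have [v [vc HE vE]] := hamiltonian_legendre hL.
have [_ _ C2] := hu P.
have -> : (fun y => feedback P y 0 i) = (fun y => v (P + grad (u ^~ P) y, y) 0 i).
  by apply/funext => y; rewrite /feedback vE.
apply: (continuous_compose (@coord_continuous_rV R n i)).
apply: (continuous_compose vc); apply: continuous_pair; last by move=> ?; exact: cvg_id.
apply: continuous_rV => j.
have -> : (fun x => (P + grad (u ^~ P) x) 0 j) = (fun x => P 0 j + partial (u ^~ P) j x).
  by apply/funext => x; rewrite !mxE.
by apply: continuous_add; [exact: cst_continuous|exact: partial_continuous].
Qed.

(** Periodicity of [L] in [x] passes to [H], and that of [u] to its gradient; the feedback is thus
    continuous and periodic. *)
Lemma feedback_bounded P : exists M, 0 <= M /\ forall y i, `|feedback P y 0 i| <= M.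
Proof.
have [uper _ _] := hu P.
have Hper p (y : 'rV[R]_n) (k : 'rV[int]_n) :
    hamiltonian L p (y + map_mx intr k) = hamiltonian L p y.
  congr sup; apply/seteqP; split => z [v _ <-]; exists v => //.
    by rewrite lagrangian_periodic.
  by rewrite lagrangian_periodic.
have bper i : Defs.periodic (fun y => feedback P y 0 i).
  move=> y k; rewrite /feedback.
  have -> : (fun p => hamiltonian L p (y + map_mx intr k)) = (fun p => hamiltonian L p y).
    by apply/funext => p; exact: Hper.
  have -> // : grad (u ^~ P) (y + map_mx intr k) = grad (u ^~ P) y.
  by apply/rowP => j; rewrite !mxE; exact: periodic_derive.
have /choice[K HK] i := periodic_bounded (bper i) (@feedback_continuous P i).
have K0 i : 0 <= K i by exact: (HK i).1.
exists (\sum_i K i); split; first exact: sumr_ge0.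
move=> y i; rewrite (le_trans ((HK i).2 y))// (bigD1 i)//= lerDl.
exact: sumr_ge0.
Qed.

(** The arithmetic of the comparison: [s] stands for the second-order terms, [H] for the
    Hamiltonians, [h] for the effective constants, [d] for the products with the feedback at [P],
    and [l] for its Lagrangian cost. *)
Let legendre_gap (sP sQ HP HQ hp hq dp dq l : R) :
  sP = HP - hp -> sQ = HQ - hq -> HP = - dp - l -> - dq - l <= HQ ->
  - (hq - hp) <= dq - dp + (sQ - sP).
Proof. lra. Qed.

(* [feedback P] is optimal in the Legendre transform at [P + D u(., P)] and merely
   admissible at [Q + D u(., Q)]. *)
Lemma corrector_generator P Q y :
  - (Hbar Q - Hbar P) <=
  dotp (grad (fun z => u z Q - u z P) y + (Q - P)) (feedback P y)
  + sigma ^+ 2 / 2 * laplacian (fun z => u z Q - u z P) y.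
Proof.
have [_ vP CP] := hu P; have [_ vQ CQ] := hu Q.
have gradB : grad (fun z => u z Q - u z P) y = grad (u ^~ Q) y - grad (u ^~ P) y.
  apply/rowP => i; rewrite !mxE -deriveB//; apply: diff_derivable.
    exact: (proj1 CQ).
  exact: (proj1 CP).
have lapB : laplacian (fun z => u z Q - u z P) y = laplacian (u ^~ Q) y - laplacian (u ^~ P) y.
  rewrite /laplacian -sumrB; apply: eq_bigr => i _.
  have -> : 'D_(delta_mx 0 i) (fun z => u z Q - u z P) =
      'D_(delta_mx 0 i) (u ^~ Q) - 'D_(delta_mx 0 i) (u ^~ P).
    apply/funext => z; apply: deriveB; apply: diff_derivable.
      exact: (proj1 CQ).
    exact: (proj1 CP).
  rewrite deriveB//; apply: diff_derivable.
    exact: (proj1 (proj2 CQ _)).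
  exact: (proj1 (proj2 CP _)).
have -> : grad (fun z => u z Q - u z P) y + (Q - P) =
    (Q + grad (u ^~ Q) y) - (P + grad (u ^~ P) y).
  by rewrite gradB opprD [LHS]addrACA; congr (_ + _); exact: addrC.
have dotpB (p q v : 'rV[R]_n) : dotp (q - p) v = dotp q v - dotp p v.
  by rewrite dotpDl -(scaleN1r p) dotpZl mulN1r.
rewrite lapB mulrBr dotpB.
exact: (legendre_gap (viscosity_classical y vP CP) (viscosity_classical y vQ CQ)
  (feedback_optimal P y) (hamiltonian_ge hL _ y (feedback P y))).
Qed.

End cell_problem.

(** [K] may depend on [h], so a single [h] is fixed first, with both slopes at [h] and [-h] within
    [e / 2] of [a]; only then is [t] taken so large that [K / (h t)] is below [e / 2]. The sign of
    [h] decides between lower and upper bound. *)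
Lemma cvg_of_slopes (R : realType) (m G : R -> R) (a : R) :
  (fun h => h^-1 * (G h - G 0)) @ 0^' --> a ->
  (forall h, exists K, forall t, 0 <= t -> - (G h - G 0) * t - K <= h * m t) ->
  m t / t @[t --> +oo] --> - a.
Proof.
move=> dG Hm; apply/cvgrPdist_le => /= e e0.
have e2 : 0 < e / 2 by rewrite divr_gt0.
have [del /= del0 Hdel] : exists2 del, 0 < del &
    forall h, h != 0 -> `|h| < del -> `|a - h^-1 * (G h - G 0)| <= e / 2.
  have /cvgrPdist_le /(_ _ e2) := dG.
  move=> /nbhs_ballP[del /= del0 Hdel]; exists del => // h h0 hdel.
  by apply: Hdel => //; rewrite /ball/= sub0r normrN.
pose h := del / 2.
have h0 : 0 < h by rewrite divr_gt0.
have hdel : h < del by rewrite /h; lra.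
have := Hdel h (lt0r_neq0 h0); rewrite gtr0_norm// => /(_ hdel) Hp.
have := Hdel (- h); rewrite oppr_eq0 normrN gtr0_norm// => /(_ (lt0r_neq0 h0) hdel) Hn.
have [K1 HK1] := Hm h; have [K2 HK2] := Hm (- h).
pose K := `|K1| + `|K2| + 1.
have K1K : K1 <= K by have := ler_norm K1; have := normr_ge0 K2; rewrite /K; lra.
have K2K : K2 <= K by have := ler_norm K2; have := normr_ge0 K1; rewrite /K; lra.
have K0 : 0 < K by have := normr_ge0 K1; have := normr_ge0 K2; rewrite /K; lra.
near=> t.
have t0 : 0 < t by near: t; exact: nbhs_pinfty_gt.
have tK : K / h / (e / 2) <= t by near: t; apply: nbhs_pinfty_ge; exact: num_real.
have hi0 : 0 < h^-1 by rewrite invr_gt0.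
have {}tK : h^-1 * K <= e / 2 * t.
  by rewrite mulrC [leRHS]mulrC -ler_pdivrMr//.
have hh : h^-1 * h = 1 by rewrite mulVf ?gt_eqF.
have H1 : - (h^-1 * (G h - G 0)) * t - h^-1 * K <= m t.
  have := ler_wpM2l (ltW hi0) (HK1 t (ltW t0)) => /=.
  rewrite [X in _ <= X]mulrA hh mul1r; apply: le_trans.
  have : h^-1 * K1 <= h^-1 * K by rewrite ler_wpM2l// ltW.
  move: h^-1 (G h - G 0) => x y; lra.
have H2 : m t <= - ((- h)^-1 * (G (- h) - G 0)) * t + h^-1 * K.
  have := ler_wpM2l (ltW hi0) (HK2 t (ltW t0)) => /=.
  rewrite [X in _ <= X]mulrA mulrN hh mulN1r lerNr => /le_trans; apply.
  have : h^-1 * K2 <= h^-1 * K by rewrite ler_wpM2l// ltW.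
  rewrite invrN; move: h^-1 (G (- h) - G 0) => x y; lra.
move: Hp Hn; rewrite !ler_distlC => /andP[p1 p2] /andP[n1 n2].
apply/andP; split.
  rewrite ler_pdivlMr//; apply: le_trans H1.
  have := ler_wpM2r (ltW t0) p2; move: (h^-1 * (G h - G 0)) (h^-1 * K) tK => x y *; lra.
rewrite ler_pdivrMr//; apply: (le_trans H2).
have := ler_wpM2r (ltW t0) n1; move: (_ * (G (- h) - G 0)) (h^-1 * K) tK => x y *; lra.
Unshelve. all: by end_near.
Qed.

Theorem theorem12 (R : realType) (n : nat)
    (L : 'rV[R]_n -> 'rV[R]_n -> R) (hL : lagrangian L)
    (sigma : R) (sigma_gt0 : 0 < sigma)
    (Hbar : 'rV[R]_n -> R)
    (hHbar : effective_hamiltonian (hamiltonian L) sigma Hbar)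
    (u : 'rV[R]_n -> 'rV[R]_n -> R)
    (hu : corrector (hamiltonian L) sigma Hbar u)
    (P : 'rV[R]_n) (hP : differentiable Hbar P)
    (d : measure_display) (T : measurableType d) (Pr : probability T R)
    (F : R -> set (set T)) (hF : filtration F)
    (w : R -> T -> 'rV[R]_n) (hw : brownian_motion Pr F w)
    (x0 : 'rV[R]_n) (x : R -> T -> 'rV[R]_n)
    (hx : diffusion Pr F w
      (fun y => - grad (fun p => hamiltonian L p y) (P + grad (u ^~ P) y))
      sigma x0 x) :
  forall i : 'I_n,
    ('E_Pr[fun omega => (x t omega 0 i / t)%R])%E @[t --> +oo] -->
      ((- grad Hbar P) 0 i)%:E.
Proof.
move=> i; have [M [M0 bM]] := feedback_bounded hL hu P.
have bc j : continuous (fun y => feedback L u P y 0 j).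
  exact: (feedback_continuous hL hu).
have hxm t : 0 <= t -> has_mean Pr (fun omega => x t omega 0 i).
  by move=> t0; exact: (position_has_mean hF hw hx sigma_gt0 bM).
pose m t := mean Pr (fun omega => x t omega 0 i).
pose G h := Hbar (h *: delta_mx 0 i + P).
have lim_m : m t / t @[t --> +oo] --> (- grad Hbar P) 0 i.
  rewrite !mxE; apply: (@cvg_of_slopes _ m G).
    have /(diff_derivable (v := delta_mx 0 i)) := hP.
    by rewrite /derivable /derive /G scale0r add0r.
  move=> h; pose Q := h *: delta_mx 0 i + P.
  have [uQper _ CQ] := hu Q; have [uPper _ CP] := hu P.
  pose f z := u z Q - u z P.
  have fC2 : Ck 2 f by exact: Ck_sub.
  have fper : Defs.periodic f by move=> z k; rewrite /f uQper uPper.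
  have fc : continuous f by move=> z; apply: differentiable_continuous; exact: (proj1 fC2).
  have [K [K0 fK]] := periodic_bounded fper fc.
  have gen := corrector_generator hL hu P Q.
  (* The values of [f] at [x0] and at the position at time [t] cost [K] each; the last term is the
     initial value of the linear part. *)
  exists (2 * K - h * x0 0 i) => t t0.
  have := supersolution_lower hF hw hx sigma_gt0 bc M0 bM fC2 fper gen t0.
  have -> : Q - P = h *: delta_mx 0 i by rewrite /Q addrK.
  rewrite dotpZl dotp_delta => H.
  have hm : has_mean Pr (fun omega => K + h * x t omega 0 i).
    by apply: has_meanD (has_mean_cst Pr K) _; apply: has_meanZ; exact: hxm.
  have {}H := le_trans H (mean_le (psi_has_mean hF hw hx sigma_gt0 bM _ fC2 fper t0) hm _).
  have HE : mean Pr (fun omega => K + h * x t omega 0 i) = K + h * m t.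
    by rewrite (meanD (has_mean_cst Pr K) (has_meanZ h (hxm t t0))) (meanZ h (hxm t t0)) mean_cst.
  move: H; rewrite HE /G scale0r add0r -/Q => H.
  have : - f x0 <= K by rewrite (le_trans (ler_norm _))// normrN.
  have : f x0 + h * x0 0 i - (Hbar Q - Hbar P) * t <= K + h * m t.
    apply: H => omega; rewrite dotpZl dotp_delta lerD2r (le_trans (ler_norm _))//.
  move: (f x0) (x0 0 i) (Hbar Q) (Hbar P) (m t) => *; lra.
have lim_E : (m t / t)%:E @[t --> +oo] --> ((- grad Hbar P) 0 i)%:E.
  by apply: cvg_EFin => //; exact: nearW.
(* For [t > 0] integrability of the position identifies the extended-real expectation with the real
   mean divided by [t]. *)
apply: cvg_trans lim_E; apply: near_eq_cvg; near=> t.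
have t0 : 0 < t by near: t; exact: nbhs_pinfty_gt.
have hxt := hxm t (ltW t0).
rewrite unlock /m mulrC -(meanZ _ hxt) /mean /Rintegral fineK; last first.
  exact: (integrable_fin_num measurableT (has_meanZ t^-1 hxt)).
by apply: eq_integral => omega _; rewrite mulrC.
Unshelve. all: by end_near.
Qed.
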